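(* Let $(\mathbb{X},d_{\mathbb{X}})$ be a Polish metric space with bounded diameter, let $\mathcal{F}$ be a class of bounded measurable functions $\mathbb{X}\to\mathbb{R}$, and let $\mathcal{I}_{\mathcal{F}}$ be the associated integral probability metric. If $\mathcal{I}_{\mathcal{F}}$ is bounded and metrizes the weak convergence on $\mathcal{P}(\mathbb{X})$, then $\mathcal{W}_{\mathcal{F}}$ metrizes the weak convergence on $\mathcal{P}(\mathcal{P}(\mathbb{X}))$. If in addition $\{ af+b : a,b\in\mathbb{R},\ f\in\mathcal{F}\}$ is dense in the space $C_b(\mathbb{X})$ of continuous bounded real functions on $\mathbb{X}$ endowed with the supremum norm, then $d_{\mathcal{F}}$ also metrizes the weak convergence on $\mathcal{P}(\mathcal{P}(\mathbb{X}))$.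
   Context: $(\mathbb{X},d_{\mathbb{X}})$ is a complete separable metric space with $\mathrm{diam}(\mathbb{X})=\sup_{x,y}d_{\mathbb{X}}(x,y)<\infty$. $\mathcal{P}(\mathbb{Y})$ denotes the Borel probability measures on a Polish space $\mathbb{Y}$; $\mathcal{P}(\mathbb{X})$ is itself Polish with the weak topology (convergence against functions in $C_b(\mathbb{X})$), and $\mathcal{P}(\mathcal{P}(\mathbb{X}))$ is endowed with weak convergence when $\mathcal{P}(\mathbb{X})$ carries its weak topology. For $P\in\mathcal{P}(\mathbb{X})$, $P(f)=\int f\,\mathrm{d}P$. $\mathcal{L}(X)$ is the law of $X$. A random probability $\tilde P$ is a random element of $\mathcal{P}(\mathbb{X})$. The integral probability metric (IPM) is $\mathcal{I}_{\mathcal{F}}(P_1,P_2)=\sup_{f\in\mathcal{F}}|P_1(f)-P_2(f)|$ for $P_1,P_2\in\mathcal{P}(\mathbb{X})$. For $\mathbb{Q}_1,\mathbb{Q}_2\in\mathcal{P}(\mathcal{P}(\mathbb{X}))$, with $\Gamma(\mathbb{Q}_1,\mathbb{Q}_2)$ the set of couplings of $\mathbb{Q}_1$ and $\mathbb{Q}_2$, the Wasserstein over IPM distance is $$\mathcal{W}_{\mathcal{F}}(\mathbb{Q}_1,\mathbb{Q}_2)=\inf_{\gamma\in\Gamma(\mathbb{Q}_1,\mathbb{Q}_2)}\mathbb{E}_{(\tilde P_1,\tilde P_2)\sim\gamma}\big(\mathcal{I}_{\mathcal{F}}(\tilde P_1,\tilde P_2)\big).$$ The hierarchical integral probability metric (HIPM)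 is $$d_{\mathcal{F}}(\mathbb{Q}_1,\mathbb{Q}_2)=\sup_{f\in\mathcal{F}}\mathcal{W}\big(\mathcal{L}(\tilde P_1(f)),\mathcal{L}(\tilde P_2(f))\big),\qquad \tilde P_i\sim\mathbb{Q}_i,$$ where $\mathcal{W}$ is the Wasserstein distance of order 1 on $\mathbb{R}$ with the usual distance. A function ''metrizes the weak convergence'' if it is a distance and convergence of sequences with respect to it is equivalent to weak convergence. *)

(* Defs.v *)
From HB Require Import structures.
From mathcomp Require Import all_boot all_order all_algebra.
From mathcomp Require Import all_classical all_reals all_analysis.

Set Implicit Arguments.
Unset Strict Implicit.
Unset Printing Implicit Defensive.

Import Order.TTheory GRing.Theory Num.Theory.
Import numFieldNormedType.Exports.

Local Open Scope classical_set_scope.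
Local Open Scope ring_scope.

#[short(type="completeMetricType")]
HB.structure Definition CompleteMetric (R : realType) :=
  {T of Metric R T & Complete T}.

Definition separable (T : topologicalType) :=
  exists2 D : set T, countable D & dense D.

Definition bounded_diameter (R : realType) (X : metricType R) :=
  exists M : R, forall x y : X, mdist x y <= M.

Definition borel (T : topologicalType) := g_sigma_algebraType (@open T).

HB.instance Definition _ (T : ptopologicalType) :=
  Measurable.on (borel T).

Definition Cb (R : realType) (T : topologicalType) : set (T -> R) :=
  [set f | continuous f /\ bounded_fun f].
Arguments Cb : clear implicits.

(* The weak topology is the coarsest one making P |-> P(f) continuous for
   every f in C_b(T), i.e. the initial topology of the evaluation map into
   R^C_b(T), the latter with the topology of pointwise convergence. *)
Definition Cb_eval (R : realType) (T : ptopologicalType)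
    (P : probability (borel T) R) :
    {ptws {f : T -> R | Cb R T f} -> R} :=
  fun f => \int[P]_x sval f x.

(* P(T): the Borel probability measures on T, with the weak topology.  Since
   P(T) is again a topological type, P(P(T)) is obtained by iterating. *)
Definition prob (R : realType) (T : ptopologicalType) : Type :=
  initial_topology (@Cb_eval R T).

HB.instance Definition _ (R : realType) (T : ptopologicalType) :=
  Topological.on (prob R T).
HB.instance Definition _ (R : realType) (T : ptopologicalType) :=
  Pointed.on (prob R T).

Lemma cvg_probE (R : realType) (T : ptopologicalType)
    (P_ : nat -> prob R T) (P : prob R T) :
  (P_ n @[n --> \oo] --> P) <->
  (forall f, Cb R T f ->
    \int[P_ n]_x f x @[n --> \oo] --> (\int[P]_x f x : R)).
Proof.
pose u n := @Cb_eval R T (P_ n); split=> [cP f fC|cP].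
  have cu : u n @[n --> \oo] --> @Cb_eval R T P.
    by apply: cvg_comp cP _; exact: initial_continuous.
  pose pr (v : {f | Cb R T f} -> R) : R := v (exist _ f fC).
  have /cvg_sup/(_ (exist _ f fC)) {}cu := cu.
  have /(cvg_comp _ _ cu) := @initial_continuous _ _ pr (Cb_eval P).
  exact.
have {}cP : u n @[n --> \oo] --> @Cb_eval R T P.
  apply/cvg_sup => -[f fC] A [_ [[B oB <-] BP BA]].
  have : \forall n \near \oo, B (\int[P_ n]_x f x).
    by apply: cP => //; rewrite nbhsE; exists B.
  by apply: filterS => n; exact: BA.
move=> A [_ [[B oB <-] BP BA]].
have : \forall n \near \oo, B (u n) by apply: cP; rewrite nbhsE; exists B.
by apply: filterS => n; exact: BA.
Qed.

(* Measures are total set functions, of which only the values on measurable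
   sets are meaningful: this is equality of P and Q as measures. *)
Definition prob_eq (R : realType) (T : ptopologicalType) (P Q : prob R T) :=
  forall A : set (borel T), measurable A -> P A = Q A.

Definition is_distance (R : realType) (T : ptopologicalType)
    (d : prob R T -> prob R T -> \bar R) :=
  [/\ (forall P Q, 0 <= d P Q < +oo)%E,
      (forall P Q, d P Q = 0%E <-> prob_eq P Q),
      (forall P Q, d P Q = d Q P) &
      (forall P Q S, d P S <= d P Q + d Q S)%E].

Definition metrizes_weak (R : realType) (T : ptopologicalType)
    (d : prob R T -> prob R T -> \bar R) :=
  is_distance d /\
  forall (P_ : nat -> prob R T) (P : prob R T),
    (d (P_ n) P @[n --> \oo] --> 0%E) <-> (P_ n @[n --> \oo] --> P).

Section transport.
Context d1 d2 (T1 : measurableType d1) (T2 : measurableType d2) (R : realType).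

Definition couplings (mu : set T1 -> \bar R) (nu : set T2 -> \bar R) :
    set (probability (T1 * T2)%type R) :=
  [set g | (forall A, measurable A -> pushforward g fst A = mu A) /\
           (forall B, measurable B -> pushforward g snd B = nu B)].

Definition transport (c : T1 -> T2 -> \bar R)
    (mu : set T1 -> \bar R) (nu : set T2 -> \bar R) : \bar R :=
  ereal_inf [set (\int[g]_z c z.1 z.2)%E | g in couplings mu nu].

End transport.

Definition wasserstein1 (R : realType) (mu nu : set R -> \bar R) : \bar R :=
  transport (fun x y : R => `|x - y|%:E) mu nu.

(* Suprema of families of nonnegative quantities are taken in [0, +oo], so
   that the supremum of the empty family is 0. *)
Definition ipm (R : realType) (X : ptopologicalType) (F : set (X -> R))
    (P1 P2 : prob R X) : \bar R :=
  supremum 0%E [set `|\int[P1]_x f x - \int[P2]_x f x|%:E | f in F].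

Definition wasserstein_ipm (R : realType) (X : ptopologicalType)
    (F : set (X -> R)) (Q1 Q2 : prob R (prob R X)) : \bar R :=
  transport (ipm F : borel (prob R X) -> borel (prob R X) -> \bar R) Q1 Q2.

(* The law of the random variable P(f) when P has law Q. *)
Definition mean_law (R : realType) (X : ptopologicalType)
    (Q : prob R (prob R X)) (f : X -> R) : set R -> \bar R :=
  pushforward Q (fun P : borel (prob R X) => \int[(P : prob R X)]_x f x).

Definition hipm (R : realType) (X : ptopologicalType) (F : set (X -> R))
    (Q1 Q2 : prob R (prob R X)) : \bar R :=
  supremum 0%E [set wasserstein1 (mean_law Q1 f) (mean_law Q2 f) | f in F].

(* The functions of F are only assumed measurable, so { a f + b } need not be
   a subset of C_b(X): density means that every g in C_b(X) is a limit of such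
   functions for the supremum norm. *)
Definition affine_dense (R : realType) (X : topologicalType)
    (F : set (X -> R)) :=
  forall g, Cb R X g -> forall e : R, 0 < e ->
    exists f a b, F f /\ forall x, `|a * f x + b - g x| <= e.

(* Main.v *)
Require Import Defs.
From HB Require Import structures.
From mathcomp Require Import all_boot all_order all_algebra.
From mathcomp Require Import all_classical all_reals all_analysis.
From mathcomp Require Import measurable_realfun ring lra.

Set Implicit Arguments.
Unset Strict Implicit.
Unset Printing Implicit Defensive.

Import Order.TTheory GRing.Theory Num.Theory.
Import numFieldNormedType.Exports.

Local Open Scope classical_set_scope.
Local Open Scope ring_scope.

(** The proof rests on three ideas.

    Countable generation.  A topology is generated by real functions
    [e 0, e 1, ...] when finitely many of them, up to a small error, form a
    neighbourhood base at every point.  Then every nonnegative lower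
    semicontinuous function is an increasing limit of finite maxima of rational
    cones over the [e j], all taken from one countable list
    ([cone_max_approx]).  This gives half of the portmanteau theorem:
    convergence of integrals on the vector lattice spanned by the [e j] implies
    weak convergence ([lattice_cvg]), and equality on it implies equality of
    measures ([lattice_prob_eq]).  It also shows that the property passes from
    [T] to the space of probability measures on [T]: the functions
    [P |-> exp (- P(g))], for [g] in the countable list of maxima of cones,
    generate the weak topology ([cone_laplace_generates]).  The weak topology is
    therefore first countable and separable, so a metric with the same
    convergent sequences has the same neighbourhoods ([sequential_metric_nbhs]).  This
    applies to the integral probability metric.

    Couplings with a density.  For a partition of unity by functions [phi i]
    with small support, the kernel [sum_i m_i phi_i(x) phi_i(y) / (p_i q_i)],
    corrected by a product term, is the density of a coupling of two measures
    [nu] and [mu]; here [p_i = nu(phi_i)], [q_i = mu(phi_i)] and [m_i] is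
    slightly below [min p_i q_i].  Its cost is small as soon as [nu(phi_i)] is close to
    [mu(phi_i)] for finitely many [i] ([small_kernel]).  With [nu] converging
    weakly to [mu] this bounds the Wasserstein distance ([transport_cvg]).
    With [nu = mu] it yields an almost diagonal coupling, which glues two
    couplings along their common marginal and proves the triangle inequality
    without disintegration ([transport_triangle]).  Conversely, Lipschitz
    functions are integrated with an error at most a multiple of the transport
    cost, and the lattice spanned by the [rho (a j)], for a dense sequence [a],
    consists of Lipschitz functions.  Hence the Wasserstein distance over a
    bounded metric metrizes weak convergence ([wasserstein_metrizes]); with the
    integral probability metric as [rho], this is the first claim.

    Laplace functionals.  The hierarchical metric is dominated by the
    Wasserstein one ([hipm_le_wasserstein]), so weak convergence implies
    convergence for it.  Conversely, if it tends to zero then the density of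
    [{a f + b}] gives convergence of the integrals of [exp (- P(g))] for every
    continuous bounded [g >= 0] ([hipm_cvg_exp]).  The span of these functionals
    is an algebra, since [exp (- P(g)) exp (- P(h)) = exp (- P(g + h))], and the
    uniform closure of an algebra of bounded functions is stable under absolute
    values ([uclosure_norm]).  It thus contains the lattice spanned by the
    generators of the weak topology, and the first idea concludes
    ([hipm_cvg_weak]). *)

(** * Bounded measurable functions *)

Section bounded_measurable.
Context (R : realType).

Lemma bounded_funP (T : Type) (f : T -> R) :
  bounded_fun f <-> exists M : R, forall x, `|f x| <= M.
Proof.
split=> [[M [_ fM]]|[M fM]].
  by exists (M + 1) => x; apply: (fM (M + 1)) => //; rewrite ltrDl.
exists M; split; first exact: num_real.
by move=> N MN x _ /=; exact: le_trans (fM x) (ltW MN).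
Qed.

Definition bmeas d (T : measurableType d) (f : T -> R) :=
  measurable_fun setT f /\ exists M : R, forall x, `|f x| <= M.

Section closure.
Context d (T : measurableType d).
Implicit Types f g : T -> R.

Lemma bmeas_cst a : bmeas (fun _ : T => a).
Proof. by split; [exact: measurable_cst | exists `|a|]. Qed.

Lemma bmeasD f g : bmeas f -> bmeas g -> bmeas (fun x => f x + g x).
Proof.
move=> [mf [M fM]] [mg [N gN]]; split; first exact: measurable_funD.
by exists (M + N) => x; rewrite (le_trans (ler_normD _ _))// lerD.
Qed.

Lemma bmeasM f g : bmeas f -> bmeas g -> bmeas (fun x => f x * g x).
Proof.
move=> [mf [M fM]] [mg [N gN]]; split; first exact: measurable_funM.
by exists (M * N) => x; rewrite normrM ler_pM.
Qed.

Lemma bmeasZ a f : bmeas f -> bmeas (fun x => a * f x).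
Proof. by move=> bf; apply: bmeasM => //; exact: bmeas_cst. Qed.

Lemma bmeasN f : bmeas f -> bmeas (fun x => - f x).
Proof.
move=> [mf [M fM]]; split; first exact: measurable_funN.
by exists M => x; rewrite normrN.
Qed.

Lemma bmeasB f g : bmeas f -> bmeas g -> bmeas (fun x => f x - g x).
Proof. by move=> bf bg; apply: bmeasD => //; exact: bmeasN. Qed.

Lemma bmeas_norm f : bmeas f -> bmeas (fun x => `|f x|).
Proof.
move=> [mf [M fM]]; split; first exact: measurableT_comp.
by exists M => x; rewrite normr_id.
Qed.

Lemma bmeas_sum (I : Type) (s : seq I) (F : I -> T -> R) :
  (forall i, bmeas (F i)) -> bmeas (fun x => \sum_(i <- s) F i x).
Proof.
move=> bF; elim: s => [|i s IH].
  by under eq_fun do rewrite big_nil; exact: bmeas_cst.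
by under eq_fun do rewrite big_cons; exact: bmeasD.
Qed.

Lemma bmeas_prod (I : Type) (s : seq I) (F : I -> T -> R) :
  (forall i, bmeas (F i)) -> bmeas (fun x => \prod_(i <- s) F i x).
Proof.
move=> bF; elim: s => [|i s IH].
  by under eq_fun do rewrite big_nil; exact: bmeas_cst.
by under eq_fun do rewrite big_cons; exact: bmeasM.
Qed.

End closure.

Lemma bmeas_comp d d' (T : measurableType d) (T' : measurableType d')
    (h : T -> T') (f : T' -> R) :
  measurable_fun setT h -> bmeas f -> bmeas (fun x => f (h x)).
Proof.
move=> mh [mf [M fM]]; split; first exact: measurableT_comp.
by exists M.
Qed.

Section integral.
Context d (T : measurableType d) (P : probability T R).
Implicit Types f g : T -> R.

Lemma bmeas_integrable f : bmeas f -> P.-integrable setT (EFin \o f).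
Proof.
move=> [mf bf]; apply: measurable_bounded_integrable => //.
- by rewrite [X in (X < _)%E]probability_setT ltry.
- exact/bounded_funP.
Qed.

Lemma int_cst a : \int[P]_x a = a.
Proof.
rewrite Rintegral_cst//; have -> : fine (P setT) = 1 by rewrite [P _]probability_setT.
by rewrite mulr1. Qed.

Lemma intD f g : bmeas f -> bmeas g ->
  \int[P]_x (f x + g x) = \int[P]_x f x + \int[P]_x g x.
Proof. by move=> bf bg; rewrite RintegralD//; exact: bmeas_integrable. Qed.

Lemma intB f g : bmeas f -> bmeas g ->
  \int[P]_x (f x - g x) = \int[P]_x f x - \int[P]_x g x.
Proof. by move=> bf bg; rewrite RintegralB//; exact: bmeas_integrable. Qed.

Lemma intZ a f : bmeas f -> \int[P]_x (a * f x) = a * \int[P]_x f x.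
Proof. by move=> bf; rewrite RintegralZl//; exact: bmeas_integrable. Qed.

Lemma int_le f g : bmeas f -> bmeas g -> (forall x, f x <= g x) ->
  \int[P]_x f x <= \int[P]_x g x.
Proof. by move=> bf bg fg; apply: le_Rintegral => //; exact: bmeas_integrable. Qed.

Lemma int_ge0 f : (forall x, 0 <= f x) -> 0 <= \int[P]_x f x.
Proof. by move=> f0; exact: Rintegral_ge0. Qed.

Lemma int_norm_le f (M : R) : bmeas f -> (forall x, `|f x| <= M) ->
  `|\int[P]_x f x| <= M.
Proof.
move=> bf fM; rewrite (le_trans (le_normr_Rintegral _ (bmeas_integrable bf)))//.
rewrite -[leRHS]int_cst; apply: int_le => //; first exact: bmeas_norm.
exact: bmeas_cst.
Qed.

Lemma int_dist_le f g (M : R) : bmeas f -> bmeas g ->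
  (forall x, `|f x - g x| <= M) ->
  `|\int[P]_x f x - \int[P]_x g x| <= M.
Proof. by move=> bf bg fgM; rewrite -intB// int_norm_le//; exact: bmeasB. Qed.

Lemma int_sum (I : Type) (s : seq I) (F : I -> T -> R) :
  (forall i, bmeas (F i)) ->
  \int[P]_x (\sum_(i <- s) F i x) = \sum_(i <- s) \int[P]_x F i x.
Proof.
move=> bF; elim: s => [|i s IH].
  by under [LHS]eq_Rintegral do rewrite big_nil; rewrite big_nil int_cst.
under [LHS]eq_Rintegral do rewrite big_cons.
by rewrite big_cons intD ?IH//; exact: bmeas_sum.
Qed.

Lemma int_EFin f : bmeas f -> (\int[P]_x (f x)%:E = (\int[P]_x f x)%:E)%E.
Proof.
by move=> bf; rewrite fineK//; exact: integrable_fin_num (bmeas_integrable bf).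
Qed.

Lemma int_cvg (u : nat -> T -> R) f (M : R) :
  (forall n, measurable_fun setT (u n)) -> (forall n x, `|u n x| <= M) ->
  (forall x, u n x @[n --> \oo] --> f x) ->
  \int[P]_x u n x @[n --> \oo] --> \int[P]_x f x.
Proof.
move=> mu uM uf.
have mf : measurable_fun setT f.
  exact: (@measurable_fun_cvg _ _ _ _ u).
have fM x : `|f x| <= M.
  have /cvgrPdist_le fu := uf x.
  apply/ler_addgt0Pl => e e0; have [N _ /(_ N (leqnn N)) /=] := fu e e0.
  move=> H; have := uM N x; have := ler_normD (f x - u N x) (u N x).
  rewrite subrK; lra.
have bf : bmeas f by split => //; exists M.
have bu n : bmeas (u n) by split => //; exists M.
have uf' x : (u n x)%:E @[n --> \oo] --> (f x)%:E.
  by apply/fine_cvgP; split; [exact: nearW | exact: uf].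
have [||_ _] := @dominated_convergence _ _ _ P setT measurableT
  (fun n x => (u n x)%:E) (fun x => (f x)%:E) (cst M%:E) _ _
  (aeW _ (fun x _ => uf' x))
  (bmeas_integrable (bmeas_cst _ M)) (aeW _ (fun x n _ => uM n x)).
- by move=> n; exact/measurable_EFinP.
- exact/measurable_EFinP.
under eq_fun => n do rewrite /= int_EFin//.
by rewrite int_EFin// => /fine_cvgP[_].
Qed.

End integral.
End bounded_measurable.
(** * Countably generated topologies *)

Lemma invS_half (R : realType) (n : nat) :
  n.+1%:R^-1 = (n.+1%:R * 2)^-1 + (n.+1%:R * 2)^-1 :> R.
Proof. by rewrite invfM; set z := _^-1; lra. Qed.

Section generated_topology.
Context (R : realType) (T : topologicalType) (e : nat -> T -> R).

(** A single integer controls both the number of coordinates and the width of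
    the boxes around [x], so they form a decreasing base of neighbourhoods. *)
Definition generates := (forall j, continuous (e j)) /\
  forall x A, nbhs x A -> exists n : nat, forall y,
    (forall j, (j < n)%N -> `|e j x - e j y| < n.+1%:R^-1) -> A y.

(** The vector lattice spanned by [1] and the [e j]; maxima come from
    [max f g = (f + g + |f - g|) / 2]. *)
Inductive lattice_span : (T -> R) -> Prop :=
| lattice_cst a : lattice_span (fun=> a)
| lattice_gen j : lattice_span (e j)
| latticeD f g : lattice_span f -> lattice_span g ->
    lattice_span (fun x => f x + g x)
| latticeZ a f : lattice_span f -> lattice_span (fun x => a * f x)
| lattice_norm f : lattice_span f -> lattice_span (fun x => `|f x|).

Lemma latticeB f g : lattice_span f -> lattice_span g ->
  lattice_span (fun x => f x - g x).
Proof.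
move=> lf lg; under eq_fun do rewrite -mulN1r.
by apply: latticeD => //; exact: latticeZ.
Qed.

Lemma lattice_max f g : lattice_span f -> lattice_span g ->
  lattice_span (fun x => Num.max (f x) (g x)).
Proof.
move=> lf lg; under eq_fun do rewrite maxr_absE mulrC.
apply: latticeZ; apply: latticeD; first exact: latticeD.
by apply: lattice_norm; exact: latticeB.
Qed.

Lemma lattice_bigmax (I : Type) (s : seq I) (F : I -> T -> R) :
  (forall i, lattice_span (F i)) ->
  lattice_span (fun x => \big[Num.max/0]_(i <- s) F i x).
Proof.
move=> lF; elim: s => [|i s IH].
  by under eq_fun do rewrite big_nil; exact: lattice_cst.
by under eq_fun do rewrite big_cons; exact: lattice_max.
Qed.

Definition box_dist (c : seq rat) (y : T) : R :=
  \big[Num.max/0]_(j < size c) `|e j y - ratr c`_j|.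

(** With [p = (q, K, c)]: height [q], slope [K], apex [c] in the coordinates
    [e 0, ..., e (size c - 1)].  The parameters are rational so that cones form a
    countable family. *)
Definition cone (p : rat * nat * seq rat) (y : T) : R :=
  Num.max 0 (ratr p.1.1 - p.1.2%:R * box_dist p.2 y).

Definition cone_nth (i : nat) (y : T) : R :=
  if unpickle i is Some p then cone p y else 0.

Definition cone_max (s : seq nat) (y : T) : R :=
  \big[Num.max/0]_(i <- s) cone_nth i y.

Lemma lattice_cone_max s : lattice_span (cone_max s).
Proof.
apply: lattice_bigmax => i; rewrite /cone_nth.
case: unpickle => [p|]; last exact: lattice_cst.
apply: lattice_max; first exact: lattice_cst.
apply: latticeB; first exact: lattice_cst.
apply: latticeZ; apply: lattice_bigmax => j; apply: lattice_norm.
by apply: latticeB; [exact: lattice_gen | exact: lattice_cst].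
Qed.

Lemma cone_max_ge0 s y : 0 <= cone_max s y.
Proof. exact: bigmax_ge_id. Qed.

Hypothesis egen : generates.

Lemma lattice_continuous u : lattice_span u -> continuous u.
Proof.
elim=> [a|j|f g _ cf _ cg|a f _ cf|f _ cf] x.
- exact: cvg_cst.
- exact: egen.1.
- exact: (cvgD (cf x) (cg x)).
- exact: (cvgM (cvg_cst a) (cf x)).
- exact: (cvg_norm (cf x)).
Qed.

Lemma box_dist_small (x : T) (n : nat) (d : R) : 0 < d ->
  exists2 c : seq rat, size c = n & box_dist c x < d.
Proof.
move=> d0; have ratj j : exists q : rat, `|e j x - ratr q| < d.
  have [q] := @rat_in_itvoo R (e j x - d) (e j x + d) ltac:(lra).
  rewrite in_itv/= => /andP[h1 h2]; exists q; rewrite ltr_distlC; apply/andP; split; lra.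
have /choice[c cd] := ratj.
exists (mkseq c n); first by rewrite size_mkseq.
apply/bigmax_ltP; split=> // j _.
by rewrite nth_mkseq// -[X in (_ < X)%N](size_mkseq c n).
Qed.

(** If [q < H x], the set where [H > q] contains a box around [x].  A cone of
    height [q], slope large enough for its support to stay in that box, and apex
    close enough to [x], lies below [H] and is close to [q] at [x]. *)
Lemma cone_lsc (H : T -> R) x (eps : R) :
  (forall y, 0 <= H y) -> (forall q, open [set y | q < H y]) -> 0 < eps ->
  exists p, (forall y, cone p y <= H y) /\ H x - eps < cone p x.
Proof.
move=> H0 oH eps0; have [Heps|epsH] := ltP (H x) eps.
  exists (0, 0%N, [::]); rewrite /cone/= rmorph0 mul0r subr0 maxxx; split; last lra.
  by move=> y; rewrite mul0r subr0 maxxx.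
have [q] := @rat_in_itvoo R (H x - eps) (H x) ltac:(lra).
rewrite in_itv/= => /andP[Hq qH].
have q0 : (0 : R) < ratr q by lra.
have [n nP] := egen.2 _ _ (open_nbhs_nbhs (conj (oH (ratr q)) qH)).
have [K KP] : exists K : nat, n.+1%:R * 2 * ratr q + 1 < K%:R :> R.
  exists (Num.bound (n.+1%:R * 2 * ratr q + 1 : R)).
  by apply: archi_boundP; apply: addr_ge0 => //; rewrite mulr_ge0// ltW.
have n0 : (0 : R) < n.+1%:R by [].
have K0 : (0 : R) < K%:R.
  by apply: lt_trans KP; apply: ltr_wpDl => //; rewrite mulr_ge0// ltW.
have t0 : 0 < ratr q - (H x - eps) by lra.
have [c cn cd] : exists2 c : seq rat, size c = n &
    box_dist c x < Num.min (n.+1%:R * 2)^-1 ((ratr q - (H x - eps)) / K%:R).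
  by apply: box_dist_small; rewrite lt_min invr_gt0 divr_gt0// mulr_gt0.
move: cd; rewrite lt_min => /andP[cd1 cd2].
exists (q, K, c); rewrite /cone/=; split => [y|]; last first.
  rewrite lt_max; apply/orP; right.
  move: cd2; rewrite ltr_pdivlMr// mulrC; lra.
have [qK|] := leP (ratr q - K%:R * box_dist c y) 0 => //.
rewrite subr_gt0 -ltr_pdivlMl// => cy.
have {}cy : box_dist c y < (n.+1%:R * 2)^-1.
  apply: (lt_trans cy); rewrite mulrC ltr_pdivrMr// ltr_pdivlMl ?mulr_gt0//.
  lra.
apply: ltW; apply: le_lt_trans (_ : ratr q < H y); last first.
  apply: nP => j jn; rewrite -cn in jn.
  have /bigmax_ltP[_ /(_ (Ordinal jn) isT)/= h1] := cd1.
  have /bigmax_ltP[_ /(_ (Ordinal jn) isT)/= h2] := cy.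
  have -> : e j x - e j y = (e j x - ratr c`_j) - (e j y - ratr c`_j) by ring.
  rewrite (le_lt_trans (ler_normB _ _))//.
  by rewrite invS_half; exact: ltrD.
have : 0 <= box_dist c y by exact: bigmax_ge_id.
by move=> d0; rewrite gerBl mulr_ge0// ltW.
Qed.

(** Enumerate all cones and, at stage [n], take the maximum of those among the
    first [n] that lie below [H]. *)
Lemma cone_max_approx (H : T -> R) :
  (forall y, 0 <= H y) -> (forall q, open [set y | q < H y]) ->
  exists s : nat -> seq nat,
    (forall n y, cone_max (s n) y <= H y) /\
    (forall y, cone_max (s n) y @[n --> \oo] --> H y).
Proof.
move=> H0 oH.
pose s n := [seq i <- iota 0 n | `[< forall y, cone_nth i y <= H y >]].
have sH n y : cone_max (s n) y <= H y.
  rewrite /cone_max big_filter; elim/big_ind: _ => //.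
    by move=> a b aH bH; rewrite ge_max aH.
  by move=> i /asboolP.
exists s; split => // y.
apply/cvgrPdist_lt => eps eps0.
have [p [pH Hp]] := cone_lsc y H0 oH eps0.
exists (pickle p).+1 => // n /= pn.
rewrite ger0_norm ?subr_ge0// ltrBlDr -ltrBlDl (lt_le_trans Hp)//.
rewrite /cone_max (_ : cone p y = cone_nth (pickle p) y); last first.
  by rewrite /cone_nth pickleK.
have : pickle p \in s n.
  rewrite mem_filter mem_iota/= add0n pn andbT; apply/asboolP => z.
  by rewrite /cone_nth pickleK.
by move=> ps; apply: le_bigmax_seq ps _.
Qed.

End generated_topology.

(** Choose one point in every nonempty box with rational centre. *)
Lemma generates_dense (R : realType) (T : ptopologicalType)
    (e : nat -> T -> R) : generates e ->
  exists a : nat -> T, forall (x : T) (A : set T), nbhs x A -> exists n, A (a n).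
Proof.
move=> egen.
pose small (c : seq rat) : set T :=
  [set y | box_dist e c y < ((size c).+1%:R * 2)^-1].
exists (fun i => if unpickle i is Some c then xget point (small c) else point).
move=> x A xA; have [n nP] := egen.2 _ _ xA.
have [|c cn cx] := box_dist_small e x n (_ : 0 < (n.+1%:R * 2)^-1).
  by rewrite invr_gt0 mulr_gt0.
exists (pickle c); rewrite pickleK; apply: nP => j jn.
have : small c (xget point (small c)).
  by apply: xgetPex; exists x; rewrite /small/= cn.
rewrite /small/=; set y := xget _ _; rewrite -cn in cx jn * => cy.
have /bigmax_ltP[_ /(_ (Ordinal jn) isT)/= h1] := cx.
have /bigmax_ltP[_ /(_ (Ordinal jn) isT)/= h2] := cy.
have -> : e j x - e j y = (e j x - ratr c`_j) - (e j y - ratr c`_j) by ring.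
rewrite (le_lt_trans (ler_normB _ _))//.
by rewrite invS_half; exact: ltrD.
Qed.

Lemma metric_continuous (R : realType) (T : topologicalType)
    (rho : T -> T -> R) :
  (forall x y, rho x y = rho y x) ->
  (forall x y z, rho x z <= rho x y + rho y z) ->
  (forall (x : T) (A : set T), nbhs x A <->
     exists2 r : R, 0 < r & forall y, rho x y < r -> A y) ->
  forall x, continuous (rho x).
Proof.
move=> rhoC rho_tri rho_nbhs z x.
apply/cvgrPdist_lt => eps eps0; apply/rho_nbhs; exists eps => // y xy.
rewrite ltr_distlC.
have := rho_tri z x y; have := rho_tri z y x; rewrite (rhoC y x).
by move=> h1 h2; apply/andP; split; lra.
Qed.

(** Knowing the distances to a dense sequence up to a small error locates a
    point: compare through a member of the sequence that is close to it. *)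
Lemma metric_generates (R : realType) (T : topologicalType)
    (rho : T -> T -> R) (a : nat -> T) :
  (forall x y, rho x y = rho y x) ->
  (forall x y z, rho x z <= rho x y + rho y z) ->
  (forall (x : T) (A : set T), nbhs x A <->
     exists2 r : R, 0 < r & forall y, rho x y < r -> A y) ->
  (forall (x : T) (A : set T), nbhs x A -> exists n, A (a n)) ->
  generates (fun j => rho (a j)).
Proof.
move=> rhoC rho_tri rho_nbhs a_dense; split=> [j|x A /rho_nbhs[r r0 rA]].
  exact: metric_continuous.
have [|j xj] := a_dense x [set y | rho x y < r / 3].
  by apply/rho_nbhs; exists (r / 3) => //; rewrite divr_gt0.
have [n rn] : exists n : nat, 3 / r < n%:R.
  by exists (Num.bound (3 / r)); apply: archi_boundP; rewrite divr_ge0// ltW.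
exists (maxn j.+1 n) => y /(_ j); rewrite leq_max leqnn => /(_ isT).
set m := maxn _ _ => ym; apply: rA.
have mr : m.+1%:R^-1 < r / 3.
  rewrite -[ltRHS]invf_div ltf_pV2 ?posrE ?divr_gt0//.
  by apply: (lt_le_trans rn); rewrite ler_nat ltnW// ltnS leq_max leqnn orbT.
move: ym xj; rewrite /= ltr_distlC => /andP[h1 h2].
have := rho_tri x (a j) y; rewrite (rhoC x (a j)).
move: mr h1 h2; set d := _^-1 => *; lra.
Qed.

(** * Borel measurability and determining classes *)

Lemma Cb_bmeas (R : realType) (T : ptopologicalType) (f : T -> R) :
  Cb R T f -> bmeas (f : borel T -> R).
Proof.
move=> [cf /bounded_funP bf]; split => //.
apply: (measurability _ (RGenOpens.measurableE R)).
move=> _ [_ [a [b ->] <-]]; rewrite setTI.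
by apply: sub_sigma_algebra; move/continuousP : cf; apply; exact: interval_open.
Qed.

Lemma lsc_measurable (R : realType) (T : ptopologicalType) (f : T -> R) :
  (forall q, open [set x | q < f x]) -> measurable_fun setT (f : borel T -> R).
Proof.
move=> of_; apply: (measurability _ (RGenOInfty.measurableE R)).
move=> _ [_ [a ->] <-]; rewrite setTI; apply: sub_sigma_algebra.
by have -> : f @^-1` `]a, +oo[ = [set x | a < f x];
  [apply/seteqP; split => x /=; rewrite in_itv/= andbT | exact: of_].
Qed.

(** Both [f] and [- f], shifted by a bound, are nonnegative and lower
    semicontinuous; applied with [a = 1] and [a = -1] this turns two one-sided
    estimates into convergence of the integrals of [f]. *)
Lemma Cb_lsc_halves (R : realType) (T : ptopologicalType) (f : T -> R) :
  Cb R T f -> exists M : R, forall a : R, `|a| = 1 ->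
  [/\ forall q, open [set x | q < a * f x + M],
      forall x, 0 <= a * f x + M <= M + M &
      forall P : prob R T, \int[P]_x (a * f x + M) = a * \int[P]_x f x + M].
Proof.
move=> Cf; have bf := Cb_bmeas Cf; have [cf /bounded_funP[M fM]] := Cf.
exists M => a a1; split => [q|x|P].
- have /continuousP/(_ _ (open_gt (y := q))) : continuous (fun x => a * f x + M).
    move=> x; apply: cvgD; last exact: cvg_cst.
    by apply: cvgM; [exact: cvg_cst | exact: cf].
  by [].
- have : `|a * f x| <= M by rewrite normrM a1 mul1r.
  by rewrite ler_norml => /andP[? ?]; apply/andP; split; lra.
- by rewrite intD ?intZ ?int_cst//; [exact: bmeasZ | exact: bmeas_cst].
Qed.

Section determining_class.
Context (R : realType) (T : ptopologicalType) (e : nat -> T -> R).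
Hypothesis egen : generates e.
Hypothesis ebounded : forall j, exists M : R, forall x, `|e j x| <= M.

Lemma lattice_bounded u : lattice_span e u -> exists M : R, forall x, `|u x| <= M.
Proof.
elim=> [a|j|f g _ [M fM] _ [N gN]|a f _ [M fM]|f _ [M fM]].
- by exists `|a|.
- exact: ebounded.
- by exists (M + N) => x; rewrite (le_trans (ler_normD _ _))// lerD.
- by exists (`|a| * M) => x; rewrite normrM ler_wpM2l.
- by exists M => x; rewrite normr_id.
Qed.

Lemma lattice_Cb u : lattice_span e u -> Cb R T u.
Proof.
move=> lu; split; first exact: lattice_continuous lu.
exact/bounded_funP/lattice_bounded.
Qed.

Lemma lattice_bmeas u : lattice_span e u -> bmeas (u : borel T -> R).
Proof. by move=> lu; exact: Cb_bmeas (lattice_Cb lu). Qed.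

(** Half of the portmanteau theorem: approximate [H] from below, in the mean for
    [Q], by an element of the lattice, and use convergence on that element. *)
Lemma lattice_cvg_lsc (Q_ : nat -> prob R T) (Q : prob R T) (H : T -> R) (M : R) :
  (forall u, lattice_span e u ->
    \int[Q_ n]_x u x @[n --> \oo] --> (\int[Q]_x u x : R)) ->
  (forall q, open [set x | q < H x]) -> (forall x, 0 <= H x <= M) ->
  forall eps : R, 0 < eps ->
    \forall n \near \oo, \int[Q]_x H x - eps <= \int[Q_ n]_x H x.
Proof.
move=> QQ oH HM eps eps0.
have H0 x : 0 <= H x by case/andP: (HM x).
have bH : bmeas (H : borel T -> R).
  split; first exact: lsc_measurable.
  by exists M => x; rewrite ger0_norm//; case/andP: (HM x).
have [s [sH sHcvg]] := cone_max_approx egen H0 oH.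
have lats k := lattice_cone_max e (s k).
have sM n x : `|cone_max e (s n) x| <= M.
  rewrite ger0_norm ?cone_max_ge0// (le_trans (sH n x))//.
  by case/andP: (HM x).
have /cvgrPdist_lt/(_ (eps / 2)) :=
  int_cvg (P := Q) (fun n => (lattice_bmeas (lats n)).1) sM sHcvg.
rewrite divr_gt0// => /(_ isT)[k _ /(_ k (leqnn k))] /= kH.
have /cvgrPdist_lt/(_ (eps / 2)) := QQ _ (lats k).
rewrite divr_gt0// => /(_ isT); apply: filterS => n nk.
have : \int[Q_ n]_x cone_max e (s k) x <= \int[Q_ n]_x H x.
  by apply: int_le => //; exact: lattice_bmeas.
move: kH nk; rewrite !ltr_distlC => /andP[h1 _] /andP[h2 _] ?; lra.
Qed.

Lemma lattice_cvg (Q_ : nat -> prob R T) (Q : prob R T) :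
  (forall u, lattice_span e u ->
    \int[Q_ n]_x u x @[n --> \oo] --> (\int[Q]_x u x : R)) ->
  Q_ n @[n --> \oo] --> Q.
Proof.
move=> QQ; apply/cvg_probE => f /Cb_lsc_halves[M fM].
have [oS bS intS] := fM 1 (normr1 R).
have [oS' bS' intS'] := fM (- 1) (normrN1 R).
apply/cvgrPdist_le => eps eps0.
have h1 := lattice_cvg_lsc QQ oS bS eps0.
have h2 := lattice_cvg_lsc QQ oS' bS' eps0.
near=> n.
have : \int[Q]_x (1 * f x + M) - eps <= \int[Q_ n]_x (1 * f x + M) by near: n.
have : \int[Q]_x (- 1 * f x + M) - eps <= \int[Q_ n]_x (- 1 * f x + M) by near: n.
rewrite !intS !intS' => ? ?.
by rewrite ler_norml; apply/andP; split; lra.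
Unshelve. all: by end_near.
Qed.

(** Indicators of open sets are lower semicontinuous, and the open sets are a
    pi-system generating the Borel sets.  The two inequalities come from the
    one-sided portmanteau bound along constant sequences. *)
Lemma lattice_prob_eq (P Q : prob R T) :
  (forall u, lattice_span e u -> \int[P]_x u x = \int[Q]_x u x) -> prob_eq P Q.
Proof.
move=> PQ.
have le_open (P' Q' : prob R T) (U : set T) : open U ->
    (forall u, lattice_span e u -> \int[P']_x u x = \int[Q']_x u x) ->
    (Q' (U : set (borel T)) <= P' (U : set (borel T)))%E.
  move=> oU PQ'.
  have mU : measurable (U : set (borel T)) by exact: sub_sigma_algebra.
  pose H : T -> R := \1_U.
  have oH (q : R) : open [set x | q < H x].
    have [q0|q0] := ltP q 0.
      rewrite (_ : [set _ | _] = setT); first exact: openT.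
      by apply/seteqP; split => x // _ /=; rewrite (lt_le_trans q0)// indicE.
    have [q1|q1] := ltP q 1.
      rewrite (_ : [set _ | _] = U)//; apply/seteqP; split => x /=.
        by rewrite /H indicE; case: (boolP (x \in U)) => [/set_mem//|]; rewrite ltNge q0.
      by move=> Ux; rewrite /H indicE mem_set.
    rewrite (_ : [set _ | _] = set0); first exact: open0.
    apply/seteqP; split => x //=; rewrite /H indicE.
    by case: (x \in U) => /=; lra.
  have H01 x : 0 <= H x <= 1 by rewrite /H indicE; case: (x \in U); rewrite /= lexx ler01.
  have intH (S : prob R T) : (S (U : set (borel T))) = (\int[S]_x H x)%:E.
    rewrite -int_EFin; last first.
      split; first exact: lsc_measurable.
      by exists 1 => x; have /andP[? ?] := H01 x; rewrite ger0_norm.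
    by have := integral_indic S measurableT mU; rewrite setIT => <-.
  rewrite !intH lee_fin; apply/ler_addgt0Pr => eps eps0.
  have [|N _ /(_ N (leqnn N))/=] := @lattice_cvg_lsc (fun=> P') Q' H 1 _ oH H01 _ eps0.
    by move=> u lu; rewrite PQ'//; exact: cvg_cst.
  lra.
have eq_open U : open U -> P (U : set (borel T)) = Q (U : set (borel T)).
  by move=> oU; apply/eqP; rewrite eq_le !le_open// => u lu; rewrite PQ.
move=> A mA.
apply: (@measure_unique _ R (borel T) (@open T) (fun=> setT) erefl
  (@openI T) (fun=> openT) _ P Q eq_open _ A mA).
- by rewrite bigcup_const.
- by move=> _; rewrite [X in (X < _)%E]probability_setT ltry.
Qed.

End determining_class.

(** * Sequential metrics on a countably generated space *)

Section sequential_metric.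
Context (R : realType) (T : topologicalType) (e : nat -> T -> R).
Hypothesis egen : generates e.

Let box (x : T) (n : nat) : set T :=
  [set y | forall j, (j < n)%N -> `|e j x - e j y| < n.+1%:R^-1].

Lemma box_mono (x : T) (m n : nat) : (m <= n)%N -> box x n `<=` box x m.
Proof.
move=> mn y yn j jm; have := yn j (leq_trans jm mn) => /lt_le_trans; apply.
by rewrite lef_pV2 ?posrE// ler_nat.
Qed.

Lemma box_nbhs (x : T) (n : nat) : nbhs x (box x n).
Proof.
have : \forall y \near x, forall j : 'I_n, `|e j x - e j y| < n.+1%:R^-1.
  apply: filter_forall => j.
  have /cvgrPdist_lt := egen.1 j x; apply; by rewrite invr_gt0.
by apply: filterS => y yj j jn; exact: (yj (Ordinal jn)).
Qed.

(** A sequential hypothesis is enough because neighbourhoods have countable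
    bases: a failure of either inclusion produces a sequence that converges for
    one structure and not for the other. *)
Lemma sequential_metric_nbhs (rho : T -> T -> R) :
  (forall x y, rho x y = rho y x) ->
  (forall (u : nat -> T) x,
     (rho (u n) x @[n --> \oo] --> 0) <-> (u n @[n --> \oo] --> x)) ->
  (forall x y, 0 <= rho x y) ->
  forall (x : T) (A : set T), nbhs x A <->
     exists2 r : R, 0 < r & forall y, rho x y < r -> A y.
Proof.
move=> rhoC rho_cvg rho0 x A; split => [xA|[r r0 rA]]; apply: contrapT => nH.
  have /choice[u uP] n : exists y, rho x y < n.+1%:R^-1 /\ ~ A y.
    apply: contrapT => /forallNP h; apply: nH.
    exists n.+1%:R^-1; first by rewrite invr_gt0.
    by move=> y xy; apply: contrapT => nAy; exact: (h y).
  have : u n @[n --> \oo] --> x.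
    apply/rho_cvg; apply/cvgrPdist_lt => eps eps0.
    have : \forall n \near \oo, n.+1%:R^-1 < eps.
      by near=> n; near: n; exact: near_infty_natSinv_lt (PosNum eps0).
    apply: filterS => n; apply: lt_trans.
    by rewrite sub0r normrN ger0_norm// rhoC; exact: (uP n).1.
  move=> /(_ _ xA)[N _ /(_ N (leqnn N))].
  exact: (uP N).2.
have /choice[u uP] n : exists y, box x n y /\ r <= rho x y.
  apply: contrapT => /forallNP h; apply: nH.
  apply: filterS (box_nbhs x n) => y xy; apply: rA; rewrite ltNge.
  by apply/negP => ry; exact: (h y).
have : u n @[n --> \oo] --> x.
  move=> B /egen.2[m mB]; exists m => // n /= mn; apply: mB.
  exact: box_mono mn _ (uP n).1.
move=> /rho_cvg/cvgrPdist_lt/(_ r r0)[N _ /(_ N (leqnn N))].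
by rewrite /= sub0r normrN ger0_norm// rhoC ltNge (uP N).2.
Unshelve. all: by end_near.
Qed.

End sequential_metric.

(** * The weak topology is countably generated *)

Section weak_topology.
Context (R : realType) (T : ptopologicalType).

Lemma int_continuous (f : T -> R) : Cb R T f ->
  continuous (fun P : prob R T => \int[P]_x f x).
Proof.
move=> fC P.
pose pr (v : {f | Cb R T f} -> R) : R := v (exist _ f fC).
have cu : Cb_eval Q @[Q --> P] --> Cb_eval P by exact: initial_continuous.
have /cvg_sup/(_ (exist _ f fC)) {}cu := cu.
have {}cu := cu (fmap_filter _ (@nbhs_filter (prob R T) P)).
have /(cvg_comp _ _ cu) := @initial_continuous _ _ pr (Cb_eval P).
exact.
Qed.

Lemma cvg_prob_filter (F : set_system (prob R T)) {FF : Filter F} (P : prob R T) :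
  (forall f, Cb R T f ->
    (fun Q : prob R T => \int[Q]_x f x) @ F --> (\int[P]_x f x : R)) ->
  F --> P.
Proof.
move=> cP.
have {}cP : @Cb_eval R T @ F --> @Cb_eval R T P.
  apply/cvg_sup => -[f fC] A [_ [[B oB <-] BP BA]].
  have : \forall Q \near F, B (\int[(Q : prob R T)]_x f x).
    by apply: cP => //; rewrite nbhsE; exists B.
  by apply: filterS => n; exact: BA.
move=> A [_ [[B oB <-] BP BA]].
have : \forall Q \near F, B (Cb_eval Q) by apply: cP; rewrite nbhsE; exists B.
by apply: filterS => n; exact: BA.
Qed.

Variable e : nat -> T -> R.
Hypothesis egen : generates e.
Hypothesis ebounded : forall j, exists M : R, forall x, `|e j x| <= M.

(** Negative exponentials serve twice: they are bounded by [1], and products of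
    such functionals are again of this form. *)
Definition cone_laplace (j : nat) (P : prob R T) : R :=
  expR (- \int[P]_x cone_max e (odflt [::] (unpickle j)) x).

Let box (P : prob R T) (n : nat) : set (prob R T) :=
  [set Q | forall j, (j < n)%N ->
    `|cone_laplace j P - cone_laplace j Q| < n.+1%:R^-1].

(** Some cone maximum [g <= H] has [P(g)] close to [P(H)], and if [exp (- Q(g))]
    is close to [exp (- P(g))] then [Q(H) >= Q(g)] cannot be much below [P(H)]. *)
Lemma cone_laplace_lsc (P : prob R T) (H : T -> R) (M eps : R) :
  (forall q, open [set x | q < H x]) -> (forall x, 0 <= H x <= M) -> 0 < eps ->
  exists n, forall Q, box P n Q -> \int[P]_x H x - eps < \int[Q]_x H x.
Proof.
move=> oH HM eps0.
have H0 x : 0 <= H x by case/andP: (HM x).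
have bH : bmeas (H : borel T -> R).
  split; first exact: lsc_measurable.
  by exists M => x; rewrite ger0_norm//; case/andP: (HM x).
have [s [sH sHcvg]] := cone_max_approx egen H0 oH.
have lats k := lattice_cone_max e (s k).
have blats k := lattice_bmeas egen ebounded (lats k).
have sM n x : `|cone_max e (s n) x| <= M.
  rewrite ger0_norm ?cone_max_ge0// (le_trans (sH n x))//.
  by case/andP: (HM x).
have /cvgrPdist_lt/(_ (eps / 2)) := int_cvg (P := P) (fun n => (blats n).1) sM sHcvg.
rewrite divr_gt0// => /(_ isT)[k _ /(_ k (leqnn k))] /= kH.
set g := cone_max e (s k) in kH.
set x := \int[P]_y g y in kH.
have d0 : 0 < expR (- x) * (eps / 2) by rewrite mulr_gt0 ?expR_gt0// divr_gt0.
have : \forall n \near \oo, n.+1%:R^-1 < expR (- x) * (eps / 2).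
  by near=> n; near: n; exact: near_infty_natSinv_lt (PosNum d0).
move=> [n1 _ /(_ (maxn n1 (pickle (s k)).+1))] /=.
rewrite leq_maxl => /(_ isT); set n := maxn _ _ => nd.
exists n => Q /(_ (pickle (s k))); rewrite leq_maxr => /(_ isT).
rewrite /cone_laplace pickleK /= -/g -/x; set y := \int[Q]_z g z => xy.
have gH : y <= \int[Q]_z H z by exact: int_le (blats k) bH (sH k).
have {kH} : \int[P]_z H z - eps / 2 < x by move: kH; rewrite ltr_distlC => /andP[].
suff : x - eps / 2 < y by lra.
rewrite ltNge; apply/negP => yx.
have : `|expR (- x) - expR (- y)| < expR (- x) * (eps / 2) := lt_trans xy nd.
apply/negP; rewrite -leNgt distrC ler_normr; apply/orP; left.
rewrite lerBrDl -[X in X + _ <= _]mulr1 -mulrDr.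
have : expR (- x) * expR (eps / 2) <= expR (- y).
  by rewrite -expRD ler_expR; lra.
apply: le_trans; rewrite ler_pM2l ?expR_gt0//; exact: expR_ge1Dx.
Unshelve. all: by end_near.
Qed.

Lemma cone_laplace_generates : generates cone_laplace.
Proof.
split=> [j P|P A PA].
  apply: continuous_comp; last exact: continuous_expR.
  apply: continuousN; apply: int_continuous.
  exact: (lattice_Cb egen ebounded (lattice_cone_max _ _)).
pose F := filter_from setT (box P).
have FF : Filter F.
  apply: filter_from_filter; first by exists 0%N.
  move=> m n _ _; exists (maxn m n) => // Q Qmn; split => j jn.
    by apply: box_mono Qmn j jn; exact: leq_maxl.
  by apply: box_mono Qmn j jn; exact: leq_maxr.
suff /(_ _ PA)[n _ nA] : F --> P by exists n => Q Qn; exact: nA.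
apply: cvg_prob_filter => f /Cb_lsc_halves[M fM].
have [oS bS intS] := fM 1 (normr1 R).
have [oS' bS' intS'] := fM (- 1) (normrN1 R).
apply/cvgrPdist_le => eps eps0.
have [n1 h1] := cone_laplace_lsc P oS bS eps0.
have [n2 h2] := cone_laplace_lsc P oS' bS' eps0.
exists (maxn n1 n2) => // Q Qn.
have := h1 Q (box_mono (leq_maxl _ _) Qn).
have := h2 Q (box_mono (leq_maxr _ _) Qn).
rewrite !intS !intS' /= => ? ?.
by rewrite ler_norml; apply/andP; split; lra.
Qed.

End weak_topology.

(** * Measures with a density *)

Section density.
Local Open Scope ereal_scope.
Context d (T : measurableType d) (R : realType) (mu : {measure set T -> \bar R}).
Variables (k : T -> R) (mk : measurable_fun setT k) (k0 : forall x, (0 <= k x)%R).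

(** The proofs that [k] is measurable and nonnegative are arguments so that the
    measure structure can be attached to the term. *)
Definition density_measure (_ : measurable_fun setT k)
  (_ : forall x, (0 <= k x)%R) (A : set T) : \bar R := \int[mu]_(x in A) (k x)%:E.

Local Notation nu := (density_measure mk k0).

Let nu0 : nu set0 = 0.
Proof. by rewrite /density_measure integral_set0. Qed.

Let nu_ge0 A : 0 <= nu A.
Proof. by apply: integral_ge0 => x _; rewrite lee_fin. Qed.

Let nu_sigma_additive : semi_sigma_additive nu.
Proof.
move=> F mF tF mUF.
rewrite [X in _ --> X](_ : _ = \sum_(i <oo) \int[mu]_(x in F i) (k x)%:E); last first.
  apply: ge0_integral_bigcup => //; last by move=> x _; rewrite lee_fin.
  by apply: measurable_funTS; exact/measurable_EFinP.
by apply: is_cvg_nneseries => n _ _; exact: nu_ge0.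
Qed.

HB.instance Definition _ := isMeasure.Build _ _ _ nu nu0 nu_ge0 nu_sigma_additive.

Import HBNNSimple.

Let integral_density_nnsfun (f : {nnsfun T >-> R}) :
  \int[nu]_x (f x)%:E = \int[mu]_x (f x * k x)%:E.
Proof.
rewrite integral_nnsfun// patch_setT sintegralE.
have fk x : (f x * k x)%R = (\sum_(y \in range f) (y * (\1_(f @^-1` [set y]) x * k x)))%R.
  rewrite {1}(fimfunE f x) fsbig_finite//= fsbig_finite//= mulr_suml.
  by apply: eq_bigr => i _; rewrite mulrA.
under [RHS]eq_integral do rewrite fk -fsumEFin//.
rewrite ge0_integral_fsum//; last 2 first.
- move=> y; apply/measurable_EFinP/measurable_funM => //.
  by apply: measurable_funM => //; exact: measurable_indic.
- move=> y x _; rewrite lee_fin mulrA mulr_ge0//.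
  rewrite indicE; case: (boolP (x \in _)) => [/set_mem/= <-|]; first by rewrite mulr1.
  by rewrite mulr0.
apply: eq_fsbigr => y /set_mem[x _ <-].
under [RHS]eq_integral do rewrite EFinM.
rewrite ge0_integralZl//; last 3 first.
- by apply/measurable_EFinP/measurable_funM => //; exact: measurable_indic.
- by move=> z _; rewrite lee_fin mulr_ge0.
- by rewrite lee_fin.
congr (_ * _); transitivity (\int[mu]_(z in f @^-1` [set f x]) (k z)%:E) => //.
rewrite [LHS]integral_mkcond.
apply: eq_integral => z _; rewrite /patch indicE.
by case: (z \in _); rewrite ?mul1r ?mul0r.
Qed.

Lemma integral_density (f : T -> \bar R) :
  measurable_fun setT f -> (forall x, 0 <= f x) ->
  \int[nu]_x f x = \int[mu]_x (f x * (k x)%:E).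
Proof.
move=> mf f0; pose f_ := nnsfun_approx measurableT mf.
have f_f x : (f_ n x)%:E @[n --> \oo] --> f x.
  by apply: cvg_nnsfun_approx => // y _; exact: f0.
have nd_f x m n : (m <= n)%N -> (f_ m x <= f_ n x)%R.
  by move=> mn; exact/lefP/nd_nnsfun_approx.
have h1 : \int[nu]_x (f_ n x)%:E @[n --> \oo] --> \int[nu]_x f x.
  rewrite (_ : (fun x => f x) = (fun x => limn (fun n => (f_ n x)%:E))); last first.
    by apply/funext => x; apply/esym/cvg_lim => //; exact: f_f.
  apply: cvg_monotone_convergence => //.
  - by move=> n; exact/measurable_EFinP/measurable_funP.
  - by move=> n y _; rewrite lee_fin.
  - by move=> y _ m n mn; rewrite lee_fin; exact: nd_f.
have h2 : \int[mu]_x (f_ n x * k x)%:E @[n --> \oo] --> \int[mu]_x (f x * (k x)%:E).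
  rewrite (_ : (fun x => f x * _) = (fun x => limn (fun n => (f_ n x * k x)%:E))); last first.
    apply/funext => x; apply/esym/cvg_lim => //.
    under eq_fun do rewrite EFinM.
    by apply: cvgeZr => //; exact: f_f.
  apply: cvg_monotone_convergence => //.
  - by move=> n; apply/measurable_EFinP/measurable_funM.
  - by move=> n y _; rewrite lee_fin mulr_ge0.
  - by move=> y _ m n mn; rewrite lee_fin ler_wpM2r//; exact: nd_f.
rewrite -(cvg_lim _ h1)// -(cvg_lim _ h2)//; congr (limn _).
by apply/funext => n; exact: integral_density_nnsfun.
Qed.

End density.

(** * Couplings and transport costs *)

Section pushforward.
Context (R : realType) d d' (T : measurableType d) (S : measurableType d').
Implicit Types (P : probability T R) (h : T -> S).

Lemma prob_pushforward P h : measurable_fun setT h ->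
  exists P' : probability S R, forall A, P' A = P (h @^-1` A).
Proof.
move=> mh; pose X : {mfun T >-> S} := HB.pack h (isMeasurableFun.Build _ _ _ _ _ mh).
by exists (distribution P X).
Qed.

Lemma ge0_integral_image P (P' : probability S R) h (f : S -> \bar R) :
  measurable_fun setT h ->
  (forall A, measurable A -> P' A = P (h @^-1` A)) ->
  measurable_fun setT f -> (forall x, 0 <= f x)%E ->
  (\int[P']_x f x = \int[P]_x f (h x))%E.
Proof.
move=> mh PP' mf f0.
rewrite -[RHS](@ge0_integral_pushforward _ _ _ _ _ _ mh P setT f)//.
by apply: eq_measure_integral => A mA _; exact: PP'.
Qed.

Lemma int_image P (P' : probability S R) h (f : S -> R) :
  measurable_fun setT h ->
  (forall A, measurable A -> P' A = P (h @^-1` A)) -> bmeas f ->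
  \int[P']_x f x = \int[P]_x f (h x).
Proof.
move=> mh PP' bf; have [M fM] := bf.2.
have bS : bmeas (fun x => f x + M) by apply: bmeasD => //; exact: bmeas_cst.
have : \int[P']_x (f x + M) = \int[P]_x (f (h x) + M).
  rewrite /Rintegral; congr fine.
  apply: (ge0_integral_image (f := fun x => (f x + M)%:E)) => //.
    by apply/measurable_EFinP; exact: bS.1.
  move=> x; rewrite lee_fin; have := fM x; rewrite ler_norml => /andP[? _]; lra.
rewrite !intD ?int_cst//; [lra | exact: bmeas_comp | exact: bmeas_cst|exact: bmeas_cst].
Qed.

End pushforward.

Section density_coupling.
Context (R : realType) d1 d2 (T1 : measurableType d1) (T2 : measurableType d2).
Variables (m1 : probability T1 R) (m2 : probability T2 R) (k : T1 * T2 -> R).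
Hypotheses (mk : measurable_fun setT k) (k0 : forall z, 0 <= k z).
Hypotheses (k1 : forall x, (\int[m2]_y (k (x, y))%:E = 1)%E)
  (k2 : forall y, (\int[m1]_x (k (x, y))%:E = 1)%E).

Let m12 : {measure set (T1 * T2) -> \bar R} := (m1 \x m2)%E.

(** The unit-mass conditions on the sections of [k] say, by Tonelli, that the
    measure of density [k] has marginals [m1] and [m2]. *)
Lemma density_coupling : exists2 g : probability (T1 * T2)%type R,
  couplings m1 m2 g & forall f, measurable_fun setT f -> (forall z, 0 <= f z)%E ->
    (\int[g]_z f z = \int[m1 \x m2]_z (f z * (k z)%:E))%E.
Proof.
pose nu : {measure set (T1 * T2) -> \bar R} := density_measure m12 mk k0.
have nuE (B : set (T1 * T2)) : measurable B ->
    (nu B = \int[m1 \x m2]_z ((\1_B z)%:E * (k z)%:E))%E.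
  move=> mB; have := integral_indic nu measurableT mB; rewrite setIT => <-.
  rewrite integral_density//.
  by apply/measurable_EFinP; exact: measurable_indic.
have mker (B : set (T1 * T2)) : measurable B ->
    measurable_fun setT (fun z => (\1_B z)%:E * (k z)%:E)%E.
  by move=> mB; apply: emeasurable_funM; apply/measurable_EFinP.
have ker0 (B : set (T1 * T2)) z : (0 <= (\1_B z)%:E * (k z)%:E :> \bar R)%E.
  by rewrite mule_ge0// lee_fin.
have kcoef1 (c : R) x : 0 <= c -> (\int[m2]_y (c%:E * (k (x, y))%:E) = c%:E)%E.
  move=> c0; rewrite ge0_integralZl_EFin ?k1 ?mule1//.
  - by move=> y _; rewrite lee_fin.
  - by apply/measurable_EFinP; exact: measurableT_comp.
have kcoef2 (c : R) y : 0 <= c -> (\int[m1]_x (c%:E * (k (x, y))%:E) = c%:E)%E.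
  move=> c0; rewrite ge0_integralZl_EFin ?k2 ?mule1//.
  - by move=> x _; rewrite lee_fin.
  - by apply/measurable_EFinP; exact: measurableT_comp.
have nu1 A : measurable A -> nu (fst @^-1` A) = m1 A.
  move=> mA; have mB : measurable (@fst T1 T2 @^-1` A).
    by rewrite -[X in measurable X]setTI; exact: measurable_fst.
  rewrite nuE//.
  rewrite (fubini_tonelli1 (fun z => (\1_(fst @^-1` A) z)%:E * (k z)%:E)%E)//;
    last exact: mker.
  have := integral_indic m1 measurableT mA; rewrite setIT => <-.
  apply: eq_integral => x _; rewrite /fubini_F -[RHS](kcoef1 _ x)//.
have nu2 A : measurable A -> nu (snd @^-1` A) = m2 A.
  move=> mA; have mB : measurable (@snd T1 T2 @^-1` A).
    by rewrite -[X in measurable X]setTI; exact: measurable_snd.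
  rewrite nuE//.
  rewrite (fubini_tonelli2 (fun z => (\1_(snd @^-1` A) z)%:E * (k z)%:E)%E)//;
    last exact: mker.
  have := integral_indic m2 measurableT mA; rewrite setIT => <-.
  apply: eq_integral => x _; rewrite /fubini_G -[RHS](kcoef2 _ x)//.
have nuT : nu setT = 1%E.
  by rewrite -(probability_setT m1) -(nu1 setT)// preimage_setT.
pose g : probability (T1 * T2)%type R :=
  HB.pack (nu : set (T1 * T2) -> \bar R) (Measure.on nu)
    (Measure_isProbability.Build _ _ _ nu nuT).
exists g; first by split => A mA; [exact: nu1 | exact: nu2].
by move=> f mf f0; exact: integral_density.
Qed.

End density_coupling.

Section transport_basic.
Context (R : realType) d1 d2 (T1 : measurableType d1) (T2 : measurableType d2).
Variables (c : T1 -> T2 -> \bar R) (mu : set T1 -> \bar R) (nu : set T2 -> \bar R).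

Lemma transport_le (g : probability (T1 * T2)%type R) : couplings mu nu g ->
  (transport c mu nu <= \int[g]_z c z.1 z.2)%E.
Proof. by move=> gC; apply: ereal_inf_lbound; exists g. Qed.

Lemma transport_ge0 : (forall x y, 0 <= c x y)%E -> (0 <= transport c mu nu)%E.
Proof.
move=> c0; apply: le_ereal_inf_tmp => _ [g _ <-].
by apply: integral_ge0 => z _; exact: c0.
Qed.

Lemma transport_lb (b : \bar R) :
  (forall g : probability (T1 * T2)%type R, couplings mu nu g ->
    b <= \int[g]_z c z.1 z.2)%E -> (b <= transport c mu nu)%E.
Proof. by move=> h; apply: le_ereal_inf_tmp => _ [g gC <-]; exact: h. Qed.

End transport_basic.

Lemma transport_sym (R : realType) d (T : measurableType d) (c : T -> T -> \bar R)
    (mu nu : set T -> \bar R) :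
  measurable_fun setT (fun z : T * T => c z.1 z.2) ->
  (forall x y, 0 <= c x y)%E -> (forall x y, c x y = c y x) ->
  (transport c mu nu <= transport c nu mu)%E.
Proof.
move=> mc c0 cC; apply: transport_lb => g [g1 g2].
have msw : measurable_fun setT (fun z : T * T => (z.2, z.1)) by exact: measurable_fun_pair.
have [g' g'E] := prob_pushforward g msw.
rewrite (_ : (\int[g]_z c z.1 z.2 = \int[g']_z c z.1 z.2)%E); last first.
  rewrite (ge0_integral_image (P := g) (h := fun z : T * T => (z.2, z.1))
    (f := fun z => c z.1 z.2))//.
  by apply: eq_integral => z _ /=; rewrite cC.
by apply: transport_le; split => A mA; rewrite /pushforward g'E;
  [exact: g2 | exact: g1].
Qed.

Lemma transport_diag (R : realType) d (T : measurableType d) (c : T -> T -> \bar R)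
    (P : probability T R) (nu : set T -> \bar R) :
  measurable_fun setT (fun z : T * T => c z.1 z.2) ->
  (forall x y, 0 <= c x y)%E -> (forall x, c x x = 0%E) ->
  (forall A, measurable A -> P A = nu A) -> transport c P nu = 0%E.
Proof.
move=> mc c0 cxx Pnu; apply/eqP; rewrite eq_le transport_ge0// andbT.
have mdg : measurable_fun setT (fun x : T => (x, x)).
  exact: measurable_fun_pair.
have [g gE] := prob_pushforward P mdg.
apply: (le_trans (transport_le (g := g) c _)).
  split => A mA; rewrite /pushforward gE; last exact: Pnu.
  by [].
rewrite (ge0_integral_image (P := P) (h := fun x => (x, x))
  (f := fun z => c z.1 z.2))//=.
by rewrite integral0_eq.
Qed.

(** The easy half of Kantorovich duality. *)
Lemma transport_lipschitz (R : realType) d (T : measurableType d)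
    (c : T -> T -> R) (P Q : probability T R) (h : T -> R) (L : R) :
  measurable_fun setT (fun z : T * T => c z.1 z.2) -> bmeas h ->
  (forall x y, 0 <= c x y) -> 0 < L ->
  (forall x y, `|h x - h y| <= L * c x y) ->
  ((`|\int[P]_x h x - \int[Q]_x h x|)%:E
     <= L%:E * transport (fun x y => (c x y)%:E) P Q)%E.
Proof.
move=> mc bh c0 L0 hL.
rewrite -lee_pdivrMl//; apply: transport_lb => g [g1 g2].
rewrite lee_pdivrMl//.
have bfst : bmeas (fun z : T * T => h z.1) by apply: bmeas_comp => //; exact: measurable_fst.
have bsnd : bmeas (fun z : T * T => h z.2) by apply: bmeas_comp => //; exact: measurable_snd.
rewrite (int_image (P := g) (P' := P) (h := fst)) => [|//|A mA|//]; last by rewrite -g1.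
rewrite (int_image (P := g) (P' := Q) (h := snd)) => [|//|A mA|//]; last by rewrite -g2.
rewrite -intB//.
apply: (@le_trans _ _ (\int[g]_z (`|h z.1 - h z.2|)%:E)%E).
  rewrite int_EFin; last by apply: bmeas_norm; exact: bmeasB.
  rewrite lee_fin; apply: le_normr_Rintegral => //.
  by apply: bmeas_integrable; exact: bmeasB.
rewrite -ge0_integralZl_EFin//; last 3 first.
- by move=> z _; rewrite lee_fin.
- exact/measurable_EFinP.
- exact: ltW.
apply: ge0_le_integral => //.
- by apply/measurable_EFinP; exact: (bmeas_norm (bmeasB bfst bsnd)).1.
- by apply/measurable_EFinP; exact: measurable_funM.
- by move=> z _; rewrite -EFinM lee_fin.
Qed.

(** * A kernel with small cost *)

Section kernel.
Context (R : realType) d (T : measurableType d) (mu nu : probability T R).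
Variables (rho : T -> T -> R) (M : R).
Hypotheses (mrho : measurable_fun setT (fun z : T * T => rho z.1 z.2))
  (rho0 : forall x y, 0 <= rho x y) (rhoM : forall x y, rho x y <= M).
Variables (N : nat) (phi : 'I_N -> T -> R) (D : R) (m : 'I_N -> R).
Hypotheses (bphi : forall i, bmeas (phi i)) (phi0 : forall i x, 0 <= phi i x)
  (phi1 : forall x, \sum_i phi i x <= 1)
  (phiD : forall i x y, phi i x != 0 -> phi i y != 0 -> rho x y <= D).
Hypotheses (M0 : 0 <= M) (D0 : 0 <= D) (m0 : forall i, 0 <= m i)
  (mnu : forall i, m i <= \int[nu]_x phi i x)
  (mmu : forall i, m i <= \int[mu]_x phi i x) (m1 : \sum_i m i < 1).

Let p i := \int[nu]_x phi i x.
Let q i := \int[mu]_x phi i x.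
Let s := \sum_i m i.

Let p0 i : 0 <= p i. Proof. exact: int_ge0. Qed.
Let q0 i : 0 <= q i. Proof. exact: int_ge0. Qed.

(** Divisions by [p i] or [q i] are harmless: [m i] vanishes with either. *)
Let small_mass i : (p i == 0) || (q i == 0) -> m i = 0.
Proof.
move=> pq; apply: le_anti; rewrite m0 andbT; case/orP: pq => /eqP <-.
- exact: mnu.
- exact: mmu.
Qed.

Let w i := m i / (p i * q i).

Let w0 i : 0 <= w i. Proof. by rewrite divr_ge0 ?mulr_ge0. Qed.

Let wq i : w i * q i = m i / p i.
Proof.
rewrite /w; have [z|] := boolP ((p i == 0) || (q i == 0)).
  by rewrite small_mass// !mul0r.
by rewrite negb_or => /andP[pi0 qi0]; rewrite invfM mulrA divfK.
Qed.

Let wp i : w i * p i = m i / q i.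
Proof.
rewrite /w; have [z|] := boolP ((p i == 0) || (q i == 0)).
  by rewrite small_mass// !mul0r.
rewrite negb_or => /andP[pi0 qi0]; rewrite (mulrC (p i)) invfM mulrA.
by rewrite divfK.
Qed.

Let mp i : m i / p i * p i = m i.
Proof.
have [pi0|pi0] := eqVneq (p i) 0; last by rewrite divfK.
by rewrite pi0 mulr0 small_mass// pi0 eqxx.
Qed.

Let mq i : m i / q i * q i = m i.
Proof.
have [qi0|qi0] := eqVneq (q i) 0; last by rewrite divfK.
by rewrite qi0 mulr0 small_mass// qi0 eqxx orbT.
Qed.

Let mp1 i : m i / p i <= 1.
Proof.
have [pi0|pi0] := eqVneq (p i) 0; first by rewrite pi0 invr0 mulr0 ler01.
have pi1 : 0 < p i by rewrite lt_def pi0 p0.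
by rewrite ler_pdivrMr// mul1r; exact: mnu.
Qed.

Let mq1 i : m i / q i <= 1.
Proof.
have [qi0|qi0] := eqVneq (q i) 0; first by rewrite qi0 invr0 mulr0 ler01.
have qi1 : 0 < q i by rewrite lt_def qi0 q0.
by rewrite ler_pdivrMr// mul1r; exact: mmu.
Qed.

Let main (x y : T) := \sum_i w i * phi i x * phi i y.
Let restl (x : T) := 1 - \sum_i m i / p i * phi i x.
Let restr (y : T) := 1 - \sum_i m i / q i * phi i y.
Let rest (x y : T) := (1 - s)^-1 * restl x * restr y.
Let k (z : T * T) := main z.1 z.2 + rest z.1 z.2.

Let s1 : 0 < 1 - s. Proof. by rewrite subr_gt0. Qed.

Let rest_ge0 (c : 'I_N -> R) x : (forall i, c i <= 1) ->
  0 <= 1 - \sum_i c i * phi i x.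
Proof.
move=> c1; rewrite subr_ge0 (le_trans _ (phi1 x))//.
by apply: ler_sum => i _; rewrite ler_piMl.
Qed.

Let main0 x y : 0 <= main x y.
Proof. by apply: sumr_ge0 => i _; apply: mulr_ge0 => //; exact: mulr_ge0. Qed.

Let rest0 x y : 0 <= rest x y.
Proof.
apply: mulr_ge0; last exact: rest_ge0.
by apply: mulr_ge0; [rewrite invr_ge0 ltW | exact: rest_ge0].
Qed.

Let brestl : bmeas restl.
Proof.
apply: bmeasB; first exact: bmeas_cst.
by apply: bmeas_sum => i; exact: bmeasZ.
Qed.

Let brestr : bmeas restr.
Proof.
apply: bmeasB; first exact: bmeas_cst.
by apply: bmeas_sum => i; exact: bmeasZ.
Qed.

Let intl : \int[nu]_x restl x = 1 - s.
Proof.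
rewrite /restl intB; [|exact: bmeas_cst|by apply: bmeas_sum => i; exact: bmeasZ].
rewrite int_cst int_sum; last by move=> i; exact: bmeasZ.
by congr (_ - _); apply: eq_bigr => i _; rewrite intZ// -/(p i) mp.
Qed.

Let intr : \int[mu]_x restr x = 1 - s.
Proof.
rewrite /restr intB; [|exact: bmeas_cst|by apply: bmeas_sum => i; exact: bmeasZ].
rewrite int_cst int_sum; last by move=> i; exact: bmeasZ.
by congr (_ - _); apply: eq_bigr => i _; rewrite intZ// -/(q i) mq.
Qed.

Let bmain1 x : bmeas (main x).
Proof. by apply: bmeas_sum => i; exact: bmeasZ. Qed.

Let brest1 x : bmeas (rest x).
Proof. exact: bmeasZ. Qed.

Let int_main1 x : \int[mu]_y main x y = 1 - restl x.
Proof.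
rewrite /main int_sum; last by move=> i; exact: bmeasZ.
rewrite /restl subKr; apply: eq_bigr => i _.
by rewrite intZ// -/(q i) mulrAC wq.
Qed.

Let int_rest1 x : \int[mu]_y rest x y = restl x.
Proof. by rewrite /rest intZ// intr mulrAC mulVf ?mul1r// gt_eqF. Qed.

Let bmain2 y : bmeas (main^~ y).
Proof.
by apply: bmeas_sum => i; apply: bmeasM; [exact: bmeasZ | exact: bmeas_cst].
Qed.

Let brest2 y : bmeas (rest^~ y).
Proof. by apply: bmeasM; [exact: bmeasZ | exact: bmeas_cst]. Qed.

Let int_main2 y : \int[nu]_x main x y = 1 - restr y.
Proof.
rewrite /main int_sum; last first.
  by move=> i; apply: bmeasM; [exact: bmeasZ | exact: bmeas_cst].
rewrite /restr subKr; apply: eq_bigr => i _.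
under eq_Rintegral do rewrite mulrAC.
by rewrite intZ// -/(p i) mulrAC wp.
Qed.

Let int_rest2 y : \int[nu]_x rest x y = restr y.
Proof.
rewrite /rest; under eq_Rintegral do rewrite mulrAC.
by rewrite intZ// intl mulrAC mulVf ?mul1r// gt_eqF.
Qed.

Let bphi1 i : bmeas (fun z : T * T => phi i z.1).
Proof. by apply: bmeas_comp => //; exact: measurable_fst. Qed.

Let bphi2 i : bmeas (fun z : T * T => phi i z.2).
Proof. by apply: bmeas_comp => //; exact: measurable_snd. Qed.

Let bmain : bmeas (fun z : T * T => main z.1 z.2).
Proof. by apply: bmeas_sum => i; apply: bmeasM => //; exact: bmeasZ. Qed.

Let brest : bmeas (fun z : T * T => rest z.1 z.2).
Proof.
apply: bmeasM.
  by apply: bmeasZ; apply: (bmeas_comp (h := fst) (f := restl)) => //;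
    exact: measurable_fst.
by apply: (bmeas_comp (h := snd) (f := restr)) => //; exact: measurable_snd.
Qed.

(** The mass [m i] is carried by pairs of points in the support of [phi i], at
    cost at most [D]; what is left, [1 - sum m], is coupled independently at cost
    at most [M].  The strict bound on [sum m] keeps the normalization of the
    independent part away from zero. *)
Lemma small_kernel : exists k : T * T -> R,
  [/\ measurable_fun setT k, (forall z, 0 <= k z),
      (forall x, (\int[mu]_y (k (x, y))%:E = 1)%E),
      (forall y, (\int[nu]_x (k (x, y))%:E = 1)%E) &
      (\int[nu \x mu]_z ((rho z.1 z.2)%:E * (k z)%:E) <=
         (D + M * (1 - \sum_i m i))%:E)%E].
Proof.
exists k; split.
- exact: (bmeasD bmain brest).1.
- by move=> z; apply: addr_ge0.
- move=> x; rewrite int_EFin; last exact: (bmeasD (bmain1 x) (brest1 x)).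
  by rewrite /k/= intD// int_main1 int_rest1 subrK.
- move=> y; rewrite int_EFin; last exact: (bmeasD (bmain2 y) (brest2 y)).
  by rewrite /k/= intD// int_main2 int_rest2 subrK.
pose B (z : T * T) := D * main z.1 z.2 + M * rest z.1 z.2.
have rhok z : rho z.1 z.2 * k z <= B z.
  rewrite /k /B mulrDr; apply: lerD; last exact: ler_wpM2r.
  rewrite /main !mulr_sumr; apply: ler_sum => i _.
  have [->|x0] := eqVneq (phi i z.1) 0; first by rewrite !(mulr0, mul0r).
  have [->|y0] := eqVneq (phi i z.2) 0; first by rewrite !(mulr0, mul0r).
  apply: ler_wpM2r; last exact: phiD x0 y0.
  by apply: mulr_ge0 => //; exact: mulr_ge0.
have bB : bmeas B by apply: bmeasD; exact: bmeasZ.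
have B0 z : 0 <= B z by rewrite addr_ge0// mulr_ge0.
apply: (@le_trans _ _ (\int[nu \x mu]_z (B z)%:E)%E).
  apply: ge0_le_integral => //.
  - by move=> z _; rewrite -EFinM lee_fin mulr_ge0// addr_ge0.
  - apply/measurable_EFinP/measurable_funM => //.
    exact: (bmeasD bmain brest).1.
  - by apply/measurable_EFinP; exact: bB.1.
  - by move=> z _; rewrite -EFinM lee_fin.
rewrite (fubini_tonelli1 (fun z => (B z)%:E)); last 2 first.
- by apply/measurable_EFinP; exact: bB.1.
- by move=> z; rewrite lee_fin.
rewrite /fubini_F (_ : (fun x => _) =
    (fun x => (D * (1 - restl x) + M * restl x)%:E)); last first.
  apply/funext => x.
  rewrite int_EFin;
    last exact: (bmeasD (bmeasZ D (bmain1 x)) (bmeasZ M (brest1 x))).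
  rewrite /B/= (intD mu (bmeasZ D (bmain1 x)) (bmeasZ M (brest1 x))).
  by rewrite (intZ mu D (bmain1 x)) (intZ mu M (brest1 x)) int_main1 int_rest1.
have b1 : bmeas (fun x => 1 - restl x) by apply: bmeasB => //; exact: bmeas_cst.
rewrite int_EFin; last exact: bmeasD (bmeasZ D b1) (bmeasZ M brestl).
rewrite intD ?intZ//; [|exact: bmeasZ|exact: bmeasZ].
rewrite intB//; last exact: bmeas_cst.
by rewrite int_cst intl subKr lee_fin -/s lerD2r ler_piMr// ltW.
Qed.

End kernel.

Lemma small_scale (R : realType) (M r : R) : 0 <= M -> 0 < r ->
  exists dl : R, [/\ 0 < dl, dl <= 1 & dl * (M + 1) <= r].
Proof.
move=> M0 r0; have M1 : 0 < M + 1 by rewrite ltr_wpDl.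
exists (Num.min 1 (r / (M + 1))); split.
- by rewrite lt_min ltr01 divr_gt0.
- by rewrite ge_min lexx.
- by rewrite -ler_pdivlMr// ge_min lexx orbT.
Qed.

(** * Bounded pseudometrics: partitions of unity and the triangle inequality *)

Section pseudometric.
Context (R : realType) d (T : measurableType d).
Variables (rho : T -> T -> R) (M : R) (a : nat -> T).
Hypotheses (rho_refl : forall x, rho x x = 0)
  (rhoC : forall x y, rho x y = rho y x)
  (rho_tri : forall x y z, rho x z <= rho x y + rho y z)
  (rhoM : forall x y, rho x y <= M)
  (mrho : forall x, measurable_fun setT (rho x))
  (a_dense : forall x r, 0 < r -> exists n, rho (a n) x < r).

Lemma pseudometric_ge0 x y : 0 <= rho x y.
Proof. have := rho_tri x y x; rewrite rho_refl (rhoC y x); lra. Qed.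
Let rho0 := pseudometric_ge0.

(** Through the dense sequence, [rho x y] is the infimum of
    [rho (a n) x + rho (a n) y]; in this way the separate measurability of [rho]
    suffices on the product of the sigma-algebras. *)
Lemma pseudometric_measurable : measurable_fun setT (fun z : T * T => rho z.1 z.2).
Proof.
have mfst : measurable_fun setT (@fst T T) by exact: measurable_fst.
have msnd : measurable_fun setT (@snd T T) by exact: measurable_snd.
pose h n (z : T * T) := rho (a n) z.1 + rho (a n) z.2.
have mh n : measurable_fun setT (h n).
  by apply: measurable_funD; apply: measurableT_comp.
apply: (measurability _ (RGenInftyO.measurableE R)) => _ [_ [r ->] <-].
rewrite setTI (_ : _ @^-1` _ = \bigcup_n (h n @^-1` `]-oo, r[)); last first.
  apply/seteqP; split => [z /=|z [n _ /=]]; rewrite !in_itv/= => zr; last first.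
    by rewrite (le_lt_trans _ zr)// /h (rhoC (a n) z.1).
  have [|n nz] := @a_dense z.1 ((r - rho z.1 z.2) / 2).
    by rewrite divr_gt0// subr_gt0.
  exists n => //=; rewrite in_itv/= /h.
  have := rho_tri (a n) z.1 z.2; lra.
apply: bigcupT_measurable => n; rewrite -[X in measurable X]setTI.
exact: mh.
Qed.

Section bumps.
Variable eps : R.
Hypothesis eps0 : 0 < eps.

(** Equal to [1] on the ball of radius [eps] around [a j], and to [0] outside
    the ball of radius [2 * eps]. *)
Definition bump (j : nat) (x : T) : R :=
  Num.min 1 (Num.max 0 (2 - rho (a j) x / eps)).

Definition uncovered (n : nat) (x : T) : R := \prod_(j < n) (1 - bump j x).

Definition partition_fun (n : nat) (x : T) : R := uncovered n x * bump n x.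

Let bump01 j x : 0 <= bump j x <= 1.
Proof. by rewrite /bump ge_min lexx le_min ler01 le_max lexx. Qed.

Let uncovered01 n x : 0 <= uncovered n x <= 1.
Proof.
elim: n => [|n /andP[IH0 IH1]]; first by rewrite /uncovered big_ord0 ler01 lexx.
have /andP[b0 b1] := bump01 n x.
rewrite /uncovered big_ord_recr/= -/(uncovered n x); apply/andP; split.
  by rewrite mulr_ge0// subr_ge0.
by rewrite mulr_ile1// ?subr_ge0// lerBlDr lerDl.
Qed.

Lemma partition_fun_ge0 n x : 0 <= partition_fun n x.
Proof.
have /andP[? _] := uncovered01 n x; have /andP[? _] := bump01 n x.
exact: mulr_ge0.
Qed.

(** The sum telescopes: [partition_fun n] is [uncovered n - uncovered n.+1]. *)
Lemma partition_fun_sum n x :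
  \sum_(i < n) partition_fun i x = 1 - uncovered n x.
Proof.
elim: n => [|n IH]; first by rewrite /uncovered !big_ord0 subrr.
rewrite big_ord_recr/= IH /uncovered big_ord_recr/= -/(uncovered n x).
by rewrite /partition_fun; ring.
Qed.

Lemma partition_fun_sum_le1 n x : \sum_(i < n) partition_fun i x <= 1.
Proof. by rewrite partition_fun_sum gerBl; case/andP: (uncovered01 n x). Qed.

Lemma partition_fun_diam n x y : partition_fun n x != 0 -> partition_fun n y != 0 ->
  rho x y <= 4 * eps.
Proof.
have near_a z : partition_fun n z != 0 -> rho (a n) z <= 2 * eps.
  rewrite mulf_eq0 negb_or => /andP[_]; apply: contraNT; rewrite -ltNge => far.
  have : 2 - rho (a n) z / eps <= 0 by rewrite subr_le0 ler_pdivlMr// ltW.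
  by rewrite /bump => /max_idPl ->; apply/eqP/min_idPr.
move=> /near_a xa /near_a ya.
have := rho_tri x (a n) y; rewrite (rhoC x (a n)); lra.
Qed.

Let bbump j : bmeas (bump j).
Proof.
split; last by exists 1 => x; have /andP[? ?] := bump01 j x; rewrite ger0_norm.
apply: measurable_minr => //; apply: measurable_maxr => //.
apply: measurable_funB => //; exact: measurable_funM.
Qed.

Lemma uncovered_bmeas n : bmeas (uncovered n).
Proof. by apply: bmeas_prod => j; apply: bmeasB => //; exact: bmeas_cst. Qed.

Lemma partition_fun_bmeas n : bmeas (partition_fun n).
Proof. by apply: bmeasM => //; exact: uncovered_bmeas. Qed.

(** By density every point is eventually covered, so the functions [uncovered n]
    decrease to [0]. *)
Lemma uncovered_cvg (P : probability T R) (r : R) : 0 < r ->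
  exists n, \int[P]_x uncovered n x < r.
Proof.
move=> r0.
have un x : uncovered n x @[n --> \oo] --> (fun=> 0 : R) x.
  have [j ja] := a_dense x eps0.
  apply: cvg_near_cst; exists j.+1 => // n /= jn.
  apply/eqP; rewrite /uncovered; apply/prodf_eq0; exists (Ordinal jn) => //=.
  rewrite subr_eq0 eq_sym /bump min_l// le_max; apply/orP; right.
  have : rho (a j) x / eps <= 1 by rewrite ler_pdivrMr// mul1r ltW.
  lra.
have un1 n x : `|uncovered n x| <= 1.
  by have /andP[? ?] := uncovered01 n x; rewrite ger0_norm.
have := int_cvg (P := P) (fun n => (uncovered_bmeas n).1) un1 un.
rewrite int_cst => /cvgrPdist_lt/(_ r r0)[n _ /(_ n (leqnn n))] /=.
rewrite sub0r normrN => h; exists n.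
exact: le_lt_trans (ler_norm _) h.
Qed.

End bumps.

(** A coupling of [P] with itself that is almost concentrated on the diagonal
    and yet has a density.  It replaces disintegration in the gluing of
    couplings. *)
Lemma diagonal_kernel (P : probability T R) (r : R) : 0 < r ->
  exists k : T * T -> R,
  [/\ measurable_fun setT k, (forall z, 0 <= k z),
      (forall x, (\int[P]_y (k (x, y))%:E = 1)%E),
      (forall y, (\int[P]_x (k (x, y))%:E = 1)%E) &
      (\int[P \x P]_z ((rho z.1 z.2)%:E * (k z)%:E) <= r%:E)%E].
Proof.
move=> r0.
have M0 : 0 <= M by exact: le_trans (rho0 (a 0) (a 0)) (rhoM _ _).
have r8 : 0 < r / 8 by rewrite divr_gt0.
have [dl [dl0 dl1 dlr]] := small_scale M0 r8.
have [N NP] := uncovered_cvg r8 P dl0.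
pose phi (i : 'I_N) := partition_fun (r / 8) i.
pose q i := \int[P]_x phi i x.
have bphi i : bmeas (phi i) by exact: partition_fun_bmeas.
have q0 i : 0 <= q i by apply: int_ge0 => x; exact: partition_fun_ge0.
have sumq : \sum_i q i = 1 - \int[P]_x uncovered (r / 8) N x.
  rewrite -int_sum//; under eq_Rintegral do rewrite partition_fun_sum.
  by rewrite intB ?int_cst//; [exact: bmeas_cst | exact: uncovered_bmeas].
have U0 : 0 <= \int[P]_x uncovered (r / 8) N x.
  apply: int_ge0 => x; have := partition_fun_sum_le1 (r / 8) N x.
  by rewrite partition_fun_sum gerBl.
pose m i := (1 - dl) * q i.
have mq i : m i <= q i by rewrite /m ler_piMl// gerBl ltW.
have summ : \sum_i m i = (1 - dl) * (1 - \int[P]_x uncovered (r / 8) N x).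
  by rewrite -sumq mulr_sumr.
have [|||k [mk k0 k1 k2 kc]] := @small_kernel _ _ _ P P rho M
  pseudometric_measurable rho0 rhoM N phi (4 * (r / 8)) m bphi
  (fun i => partition_fun_ge0 (r / 8) i) (partition_fun_sum_le1 (r / 8) N)
  (fun i => @partition_fun_diam _ r8 i) M0 _ _ mq mq _.
- by rewrite mulr_ge0// ltW.
- by move=> i; rewrite mulr_ge0// subr_ge0.
- rewrite summ.
  nra.
exists k; split => //; apply: (le_trans kc); rewrite lee_fin summ.
have : M * (1 - (1 - dl) * (1 - \int[P]_x uncovered (r / 8) N x)) <= M * (2 * dl).
  rewrite ler_wpM2l//; nra.
nra.
Qed.

Let c (x y : T) : \bar R := (rho x y)%:E.

Let mc : measurable_fun setT (fun z : T * T => c z.1 z.2).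
Proof. by apply/measurable_EFinP; exact: pseudometric_measurable. Qed.

Let c0 x y : (0 <= c x y)%E. Proof. by rewrite lee_fin. Qed.

(** Take [((x, y), (y', z))] with [(x, y)] of law [g12], [(y', z)] of law [g23]
    and [(y, y')] weighted by an almost diagonal kernel; then
    [rho x z <= rho x y + rho y y' + rho y' z]. *)
Lemma transport_glue (P : probability T R) (mu nu : set T -> \bar R)
    (g12 g23 : probability (T * T)%type R) (r : R) :
  couplings mu P g12 -> couplings P nu g23 -> 0 < r ->
  (transport c mu nu <=
     \int[g12]_z c z.1 z.2 + \int[g23]_z c z.1 z.2 + r%:E)%E.
Proof.
move=> [g12l g12r] [g23l g23r] r0.
have [k [mk k0 k1 k2 kr]] := diagonal_kernel P r0.
have mfst (S S' : measurableType d) : measurable_fun setT (@fst S S') by exact: measurable_fst.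
have msnd (S S' : measurableType d) : measurable_fun setT (@snd S S') by exact: measurable_snd.
pose TT := (T * T)%type.
have m1 : measurable_fun setT (@fst TT TT) by exact: measurable_fst.
have m2 : measurable_fun setT (@snd TT TT) by exact: measurable_snd.
have mx : measurable_fun setT (fun z : TT * TT => z.1.1) by exact: measurableT_comp.
have my : measurable_fun setT (fun z : TT * TT => z.1.2) by exact: measurableT_comp.
have my' : measurable_fun setT (fun z : TT * TT => z.2.1) by exact: measurableT_comp.
have mz : measurable_fun setT (fun z : TT * TT => z.2.2) by exact: measurableT_comp.
have mmid : measurable_fun setT (fun z : TT * TT => (z.1.2, z.2.1)).
  exact: measurable_fun_pair.
have mout : measurable_fun setT (fun z : TT * TT => (z.1.1, z.2.2)).
  exact: measurable_fun_pair.
pose k' (z : TT * TT) := k (z.1.2, z.2.1).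
have mk' : measurable_fun setT k' by exact: measurableT_comp.
have mEk : measurable_fun setT (fun z => (k z)%:E) by exact/measurable_EFinP.
have k1' z : (\int[g23]_w (k' (z, w))%:E = 1)%E.
  rewrite -(k1 z.2) (ge0_integral_image (P := g23) (h := fst)
    (f := fun y => (k (z.2, y))%:E))//.
  - by move=> A mA; rewrite -g23l.
  - by apply/measurable_EFinP; exact: measurableT_comp.
  - by move=> y; rewrite lee_fin.
have k2' w : (\int[g12]_z (k' (z, w))%:E = 1)%E.
  rewrite -(k2 w.1) (ge0_integral_image (P := g12) (h := snd)
    (f := fun y => (k (y, w.1))%:E))//.
  - by move=> A mA; rewrite -g12r.
  - by apply/measurable_EFinP; exact: measurableT_comp.
  - by move=> y; rewrite lee_fin.
have [G [G1 G2] Gint] := density_coupling mk' (fun z => k0 _) k1' k2'.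
have [g gE] := prob_pushforward G mout.
have gC : couplings mu nu g.
  split=> A mA; rewrite /pushforward gE.
    have mB : measurable (@fst T T @^-1` A).
      by rewrite -[X in measurable X]setTI; exact: mfst.
    by rewrite -(g12l A mA) -[RHS](G1 _ mB).
  have mB : measurable (@snd T T @^-1` A).
    by rewrite -[X in measurable X]setTI; exact: msnd.
  by rewrite -(g23r A mA) -[RHS](G2 _ mB).
apply: (le_trans (transport_le c gC)).
rewrite (ge0_integral_image (P := G) (h := fun z => (z.1.1, z.2.2))
  (f := fun z => c z.1 z.2))//=.
have mcxy : measurable_fun setT (fun z : TT * TT => c z.1.1 z.1.2).
  exact: (measurableT_comp mc m1).
have mcyy : measurable_fun setT (fun z : TT * TT => c z.1.2 z.2.1).
  exact: (measurableT_comp mc mmid).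
have mcyz : measurable_fun setT (fun z : TT * TT => c z.2.1 z.2.2).
  exact: (measurableT_comp mc m2).
apply: (@le_trans _ _ (\int[G]_z (c z.1.1 z.1.2 + c z.2.1 z.2.2 + c z.1.2 z.2.1))%E).
  apply: ge0_le_integral => //.
  - exact: (measurableT_comp mc mout).
  - by apply: emeasurable_funD => //; exact: emeasurable_funD.
  - move=> z _; rewrite /c -!EFinD lee_fin.
    have := rho_tri z.1.1 z.1.2 z.2.2; have := rho_tri z.1.2 z.2.1 z.2.2; lra.
rewrite ge0_integralD//; last 2 first.
- by move=> z _; rewrite adde_ge0.
- exact: emeasurable_funD.
rewrite ge0_integralD//.
have -> : (\int[G]_z c z.1.1 z.1.2 = \int[g12]_z c z.1 z.2)%E.
  rewrite [RHS](ge0_integral_image (P := G) (h := fst)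
    (f := fun z => c z.1 z.2))// => A mA.
  by rewrite -G1.
have -> : (\int[G]_z c z.2.1 z.2.2 = \int[g23]_z c z.1 z.2)%E.
  rewrite [RHS](ge0_integral_image (P := G) (h := snd)
    (f := fun z => c z.1 z.2))// => A mA.
  by rewrite -G2.
rewrite leeD2l// Gint//.
pose H (z : T * T) : \bar R := (c z.1 z.2 * (k z)%:E)%E.
have mH : measurable_fun setT H by exact: emeasurable_funM.
have H0 z : (0 <= H z)%E by rewrite mule_ge0// lee_fin.
rewrite (fubini_tonelli1 (fun z => H (z.1.2, z.2.1)))//; last exact: measurableT_comp.
apply: le_trans kr; rewrite (fubini_tonelli1 H)//.
have mFH : measurable_fun setT (fubini_F P H) by exact: measurable_fun_fubini_tonelli_F.
rewrite [leRHS](ge0_integral_image (P := g12) (h := snd))//; last 2 first.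
- by move=> A mA; rewrite -g12r.
- by move=> y; apply: integral_ge0.
rewrite le_eqVlt; apply/orP; left; apply/eqP; apply: eq_integral => z _.
rewrite /fubini_F/= [RHS](ge0_integral_image (P := g23) (h := fst))//.
- by move=> A mA; rewrite -g23l.
- exact: measurableT_comp.
Qed.

Lemma transport_triangle (P : probability T R) (mu nu : set T -> \bar R) :
  (transport c mu nu <= transport c mu P + transport c P nu)%E.
Proof.
have t12 : (0 <= transport c mu P)%E by exact: transport_ge0.
have t23 : (0 <= transport c P nu)%E by exact: transport_ge0.
have [->|f12] := eqVneq (transport c mu P) +oo%E.
  by rewrite addye ?leey// gt_eqF// (lt_le_trans _ t23).
have [->|f23] := eqVneq (transport c P nu) +oo%E.
  by rewrite addey ?leey// gt_eqF// (lt_le_trans _ t12).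
apply/lee_addgt0Pr => r r0.
have r3 : 0 < r / 3 by rewrite divr_gt0.
have [|_ [g12 C12 <-] h12] := lb_ereal_inf_adherent r3 (_ : transport c mu P \is a fin_num).
  by rewrite ge0_fin_numE// lt_neqAle f12 leey.
have [|_ [g23 C23 <-] h23] := lb_ereal_inf_adherent r3 (_ : transport c P nu \is a fin_num).
  by rewrite ge0_fin_numE// lt_neqAle f23 leey.
apply: (le_trans (transport_glue C12 C23 r3)).
have -> : r%:E = ((r / 3)%:E + (r / 3)%:E + (r / 3)%:E :> \bar R)%E.
  by rewrite -!EFinD; congr EFin; lra.
set s := (r / 3)%:E; set t := transport c mu P; set t' := transport c P nu.
have -> : (t + t' + (s + s + s) = (t + s) + (t' + s) + s)%E.
  by rewrite (addeA (t + t')%E) (addeACA t).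
by apply: leeD => //; apply: leeD; exact: ltW.
Qed.

Lemma transport_partition_le (mu nu : probability T R) (eps : R) (N : nat)
    (m : 'I_N -> R) : 0 < eps -> (forall i, 0 <= m i) ->
  (forall i : 'I_N, m i <= \int[nu]_x partition_fun eps i x) ->
  (forall i : 'I_N, m i <= \int[mu]_x partition_fun eps i x) ->
  \sum_i m i < 1 ->
  (transport c nu mu <= (4 * eps + M * (1 - \sum_i m i))%:E)%E.
Proof.
move=> eps0 m0 mnu mmu m1.
have M0 : 0 <= M by exact: le_trans (rho0 (a 0) (a 0)) (rhoM _ _).
have [|k [mk k0 k1 k2 kc]] := @small_kernel _ _ _ mu nu rho M
  pseudometric_measurable rho0 rhoM N (fun i => partition_fun eps i)
  (4 * eps) m (fun i => partition_fun_bmeas eps i)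
  (fun i => partition_fun_ge0 eps i) (partition_fun_sum_le1 eps N)
  (fun i => @partition_fun_diam _ eps0 i) M0 _ m0 mnu mmu m1.
  by rewrite mulr_ge0// ltW.
have [g gC gint] := density_coupling mk k0 k1 k2.
by apply: (le_trans (transport_le c gC)); rewrite gint.
Qed.

Lemma transport_bounded (mu nu : probability T R) :
  (transport c nu mu <= (4 + M)%:E)%E.
Proof.
have := @transport_partition_le mu nu 1 0 (fun=> 0) ltr01.
by rewrite big_ord0 mulr1 subr0 mulr1; apply=> // -[].
Qed.

(** Finitely many [partition_fun] carry almost all the mass of [mu], hence
    eventually of [mu_ n], and the two measures give them almost the same
    masses. *)
Lemma transport_cvg (mu_ : nat -> probability T R) (mu : probability T R) :
  (forall eps i, 0 < eps -> \int[mu_ n]_x partition_fun eps i x @[n --> \oo] -->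
     (\int[mu]_x partition_fun eps i x : R)) ->
  transport c (mu_ n) mu @[n --> \oo] --> 0%E.
Proof.
move=> mu_cvg.
have M0 : 0 <= M by exact: le_trans (rho0 (a 0) (a 0)) (rhoM _ _).
suff small (r : R) : 0 < r ->
    \forall n \near \oo, (transport c (mu_ n) mu <= r%:E)%E.
  have t0 n : (0 <= transport c (mu_ n) mu)%E by exact: transport_ge0.
  have fin n : transport c (mu_ n) mu \is a fin_num.
    by rewrite ge0_fin_numE// (le_lt_trans (transport_bounded _ _))// ltry.
  apply/fine_cvgP; split; first exact: nearW.
  apply/cvgrPdist_le => r /small; apply: filterS => n /= h.
  by rewrite sub0r normrN ger0_norm ?fine_ge0// -lee_fin fineK.
move=> r0.
have r8 : 0 < r / 8 by rewrite divr_gt0.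
have [dl [dl0 dl1 dlM]] := small_scale M0 r8.
have [N NP] := uncovered_cvg r8 mu dl0.
pose q (i : 'I_N) := \int[mu]_x partition_fun (r / 8) i x.
pose p n (i : 'I_N) := \int[mu_ n]_x partition_fun (r / 8) i x.
have q0 i : 0 <= q i by apply: int_ge0 => x; exact: partition_fun_ge0.
have p0 n i : 0 <= p n i by apply: int_ge0 => x; exact: partition_fun_ge0.
have sumq : \sum_i q i = 1 - \int[mu]_x uncovered (r / 8) N x.
  rewrite -int_sum//; last by move=> i; exact: partition_fun_bmeas.
  under eq_Rintegral do rewrite partition_fun_sum.
  by rewrite intB ?int_cst//; [exact: bmeas_cst | exact: uncovered_bmeas].
have U0 : 0 <= \int[mu]_x uncovered (r / 8) N x.
  apply: int_ge0 => x; have := partition_fun_sum_le1 (r / 8) N x.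
  by rewrite partition_fun_sum gerBl.
pose m n (i : 'I_N) := (1 - dl) * Num.min (p n i) (q i).
have m0 n i : 0 <= m n i.
  by apply: mulr_ge0; [rewrite subr_ge0 | rewrite le_min p0 q0].
have mmin n i : m n i <= Num.min (p n i) (q i).
  apply: ler_piMl; first by rewrite le_min p0 q0.
  by rewrite gerBl ltW.
have mp n i : m n i <= p n i.
  by apply: (le_trans (mmin n i)); rewrite ge_min lexx.
have mq n i : m n i <= q i.
  by apply: (le_trans (mmin n i)); rewrite ge_min lexx orbT.
have summ n : \sum_i m n i = (1 - dl) * \sum_i Num.min (p n i) (q i).
  by rewrite mulr_sumr.
have minq n : \sum_i Num.min (p n i) (q i) <= \sum_i q i.
  by apply: ler_sum => i _; rewrite ge_min lexx orbT.
have min0 n : 0 <= \sum_i Num.min (p n i) (q i).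
  by apply: sumr_ge0 => i _; rewrite le_min p0 q0.
have m1 n : \sum_i m n i < 1.
  rewrite summ; have := minq n; have := min0 n; rewrite sumq; nra.
have dN0 : 0 < dl / N.+1%:R by rewrite divr_gt0.
have : \forall n \near \oo, forall i : 'I_N, q i - dl / N.+1%:R <= p n i.
  apply: filter_forall => i.
  have /cvgrPdist_le/(_ _ dN0) := mu_cvg (r / 8) i r8.
  apply: filterS => n h; rewrite lerBlDr -lerBlDl.
  exact: le_trans (ler_norm _) h.
apply: filterS => n nP.
apply: (le_trans (transport_partition_le r8 (m0 n) (mp n) (mq n) (m1 n))).
have summin : \sum_i q i - dl <= \sum_i Num.min (p n i) (q i).
  apply: (@le_trans _ _ (\sum_i (q i - dl / N.+1%:R))).
    rewrite sumrB lerD2l lerN2.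
    have -> : \sum_(i < N) dl / N.+1%:R = dl / N.+1%:R * N%:R :> R.
      by rewrite sumr_const card_ord mulr_natr.
    by rewrite mulrAC ler_pdivrMr// ler_wpM2l ?ler_nat// ltW.
  by apply: ler_sum => i _; rewrite le_min nP/= gerBl ltW.
rewrite lee_fin summ.
have : M * (1 - (1 - dl) * \sum_i Num.min (p n i) (q i)) <= M * (3 * dl).
  rewrite ler_wpM2l//; have := minq n; have := min0 n.
  by rewrite sumq in summin *; nra.
nra.
Qed.

End pseudometric.

(** * Wasserstein distances metrize weak convergence *)

Section wasserstein_metrizes.
Context (R : realType) (T : ptopologicalType).
Variables (rho : T -> T -> R) (M : R) (a : nat -> T).
Hypotheses (rho_refl : forall x, rho x x = 0)
  (rhoC : forall x y, rho x y = rho y x)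
  (rho_tri : forall x y z, rho x z <= rho x y + rho y z)
  (rhoM : forall x y, rho x y <= M)
  (rho_nbhs : forall (x : T) (A : set T), nbhs x A <->
     exists2 r : R, 0 < r & forall y, rho x y < r -> A y)
  (a_nbhs : forall (x : T) (A : set T), nbhs x A -> exists n, A (a n)).

Let W (P Q : prob R T) : \bar R :=
  transport (fun x y : borel T => (rho x y)%:E) P Q.

Let rho0 : forall x y, 0 <= rho x y :=
  pseudometric_ge0 (T := borel T) rho_refl rhoC rho_tri.

Let rho_cont x : continuous (rho x).
Proof. exact: (metric_continuous rhoC rho_tri rho_nbhs). Qed.

Let rho_bounded x : bounded_fun (rho x).
Proof. by apply/bounded_funP; exists M => y; rewrite ger0_norm. Qed.

Let mrho x : measurable_fun setT (rho x : borel T -> R).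
Proof. by have [mx _] := Cb_bmeas (conj (@rho_cont x) (@rho_bounded x)). Qed.

Let a_dense (x : T) (r : R) : 0 < r -> exists n, rho (a n) x < r.
Proof.
move=> r0; have [|n nx] := a_nbhs (x := x) (A := [set y | rho x y < r]).
  by apply/rho_nbhs; exists r.
by exists n; rewrite rhoC.
Qed.

Lemma metric_measurable :
  measurable_fun setT (fun z : borel T * borel T => rho z.1 z.2).
Proof.
exact: (pseudometric_measurable (T := borel T) rhoC rho_tri mrho a_dense).
Qed.
Let mrho2 := metric_measurable.

Let e j := rho (a j).

Let pbump := @bump R _ (borel T) rho a.
Let punc := @uncovered R _ (borel T) rho a.

Let egen : generates e := metric_generates rhoC rho_tri rho_nbhs a_nbhs.

Let ebounded j : exists N : R, forall x, `|e j x| <= N.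
Proof. by exists M => x; rewrite ger0_norm// /e. Qed.

Lemma lattice_lipschitz u : lattice_span e u ->
  exists2 L : R, 0 < L & forall x y, `|u x - u y| <= L * rho x y.
Proof.
elim=> [b|j|f g _ [L L0 fL] _ [K K0 gK]|b f _ [L L0 fL]|f _ [L L0 fL]].
- by exists 1 => // x y; rewrite subrr normr0 mul1r.
- exists 1 => // x y; rewrite mul1r ler_norml /e.
  have := rho_tri (a j) x y; have := rho_tri (a j) y x; rewrite (rhoC y x).
  by move=> ? ?; apply/andP; split; lra.
- exists (L + K) => [|x y]; first exact: addr_gt0.
  rewrite opprD addrACA mulrDl (le_trans (ler_normD _ _))//.
  by apply: lerD.
- exists (`|b| * L + 1) => [|x y]; first by rewrite ltr_wpDl// mulr_ge0// ltW.
  rewrite -mulrBr normrM (@le_trans _ _ (`|b| * (L * rho x y)))//.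
    exact: ler_wpM2l.
  by rewrite mulrA ler_wpM2r// lerDl.
- exists L => // x y; exact: le_trans (ler_dist_dist _ _) (fL x y).
Qed.

Lemma transport_lattice (P Q : prob R T) u : lattice_span e u ->
  exists2 L : R, 0 < L &
  ((`|\int[P]_x u x - \int[Q]_x u x|)%:E <= L%:E * W P Q)%E.
Proof.
move=> lu; have [L L0 uL] := lattice_lipschitz lu; exists L => //.
apply: (@transport_lipschitz _ _ (borel T) rho P Q u L) => //.
exact: (lattice_bmeas egen ebounded lu).
Qed.

Let W_ge0 P Q : (0 <= W P Q)%E.
Proof. by apply: transport_ge0 => x y; rewrite lee_fin. Qed.

Let W_fin P Q : W P Q \is a fin_num.
Proof.
rewrite ge0_fin_numE//; apply: le_lt_trans (ltry (4 + M)).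
exact: (transport_bounded (T := borel T) rho_refl rhoC rho_tri rhoM mrho a_dense).
Qed.

Lemma continuous_partition_fun (eps : R) n :
  continuous (partition_fun (T := borel T) rho a eps n : T -> R).
Proof.
have cbump j : continuous (pbump eps j : T -> R).
  have c1 : continuous (fun x : T => 2 - rho (a j) x / eps).
    move=> x; apply: cvgB; first exact: cvg_cst.
    by apply: cvgMr_tmp; exact: rho_cont.
  have cst_cont (b : R) (x : T) : {for x, continuous (fun=> b)} by exact: cvg_cst.
  move=> x; apply: (continuous_min (cst_cont 1 x)).
  exact: (continuous_max (cst_cont 0 x) (c1 x)).
have cunc m : continuous (punc eps m : T -> R).
  elim: m => [|m IH] x.
    rewrite (_ : punc _ _ = fun=> 1); first exact: cvg_cst.
    by apply/funext => y; rewrite /punc/uncovered big_ord0.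
  rewrite (_ : punc _ _ = fun y => punc eps m y * (1 - pbump eps m y)).
    apply: cvgM; first exact: IH.
    by apply: cvgB; [exact: cvg_cst | exact: cbump].
  by apply/funext => y; rewrite /punc/uncovered big_ord_recr.
by move=> x; apply: cvgM; [exact: cunc | exact: cbump].
Qed.

Lemma wasserstein_distance : is_distance W.
Proof.
have mW : measurable_fun setT (fun z : borel T * borel T => (rho z.1 z.2)%:E).
  exact/measurable_EFinP.
split => [P Q|P Q|P Q|P Q S].
- by rewrite W_ge0 ltey_eq W_fin.
- split => [W0|PQ]; last first.
    by apply: transport_diag => // x; rewrite rho_refl.
  apply: (lattice_prob_eq egen ebounded) => u lu.
  have [L L0] := transport_lattice P Q lu.
  by rewrite W0 mule0 lee_fin normr_le0 subr_eq0 => /eqP.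
- by apply: le_anti; apply/andP; split; apply: transport_sym => // x y; rewrite rhoC.
- exact: (transport_triangle (T := borel T) rho_refl rhoC rho_tri rhoM mrho a_dense).
Qed.

Lemma wasserstein_metrizes : metrizes_weak W.
Proof.
split; first exact: wasserstein_distance.
move=> P_ P; split => [WP|PP]; last first.
  apply: (transport_cvg (T := borel T) rho_refl rhoC rho_tri rhoM mrho a_dense).
  move=> eps i eps0; move/cvg_probE : PP; apply; split.
    exact: continuous_partition_fun.
  by apply/bounded_funP; have [] := partition_fun_bmeas (T := borel T) a mrho eps i.
apply: (lattice_cvg egen ebounded) => u lu.
apply/cvgrPdist_lt => r r0.
have [L L0 uL] := lattice_lipschitz lu.
have /fine_cvgP[_ /cvgrPdist_lt/(_ (r / L))] := WP.
rewrite divr_gt0// => /(_ isT); apply: filterS => n /=.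
rewrite sub0r normrN ger0_norm ?fine_ge0// => WrL.
rewrite distrC -lte_fin.
apply: (@le_lt_trans _ _ (L%:E * W (P_ n) P)%E).
  apply: (@transport_lipschitz _ _ (borel T) rho (P_ n) P u L) => //.
  exact: (lattice_bmeas egen ebounded lu).
by rewrite -[W _ _]fineK// -EFinM lte_fin mulrC -ltr_pdivlMr.
Qed.

End wasserstein_metrizes.

(** * The integral probability metric *)

Section supremum_ge0.
Context (R : realType).
Implicit Type S : set (\bar R).

Lemma le_supremum0 S t : S t -> (t <= supremum 0%E S)%E.
Proof. exact: ge_supremum_Nmem (ereal_supremums_neq0 S). Qed.

Lemma supremum0_le S b : (0 <= b)%E -> (forall t, S t -> (t <= b)%E) ->
  (supremum 0%E S <= b)%E.
Proof.
move=> b0 Sb; rewrite /supremum; case: ifPn => // _.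
case: xgetP => [y -> [_ lb]|_//]; exact: lb.
Qed.

Lemma supremum0_ge0 S : (forall t, S t -> (0 <= t)%E) -> (0 <= supremum 0%E S)%E.
Proof.
move=> S0; have [->|/set0P[t St]] := eqVneq S set0; first by rewrite supremum0.
exact: le_trans (S0 t St) (le_supremum0 St).
Qed.

End supremum_ge0.

Lemma separable_dense_seq (T : ptopologicalType) : separable T ->
  exists a : nat -> T, forall (x : T) (A : set T), nbhs x A -> exists n, A (a n).
Proof.
move=> [D /countable_injP[f finj] dD].
exists (fun n => xget point [set x | D x /\ f x = n]) => x A.
rewrite nbhsE => -[U [oU Ux] UA].
have [y [Uy Dy]] := dD U (ex_intro _ x Ux) oU.
exists (f y); case: xgetP => [z _ [Dz fzy]|/(_ y)]; last by case.
by apply: UA; rewrite (finj z y) ?inE.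
Qed.

Lemma metric_space_generates (R : realType) (X : completeMetricType R) :
  separable X ->
  exists a : nat -> X, generates (fun j => mdist (a j)).
Proof.
move=> /(@separable_dense_seq X)[a a_dense]; exists a.
apply: metric_generates => //.
- exact: metric_sym.
- exact: metric_triangle.
- move=> x A; split.
    move=> /(metricType_numDomainType.nbhs_mdistP x A)[r /= r0 rA].
    by exists r.
  move=> [r r0 rA].
  by apply/(metricType_numDomainType.nbhs_mdistP x A); exists r.
Qed.

Section ipm.
Context (R : realType) (X : completeMetricType R).
Hypotheses (sepX : separable X) (diamX : bounded_diameter X).
Variable F : set (X -> R).
Hypotheses (ipm_bounded : exists M : R, forall P1 P2 : prob R X,
       (ipm F P1 P2 <= M%:E)%E)
    (ipm_metrizes : metrizes_weak (ipm F)).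

Definition ripm (P Q : prob R X) : R := fine (ipm F P Q).

Lemma ripmE P Q : (ripm P Q)%:E = ipm F P Q.
Proof.
have [[h _ _ _] _] := ipm_metrizes; have /andP[h0 h1] := h P Q.
by rewrite fineK// ge0_fin_numE.
Qed.

Lemma ripm_refl P : ripm P P = 0.
Proof. by have [[_ h _ _] _] := ipm_metrizes; rewrite /ripm (h P P).2. Qed.

Lemma ripmC P Q : ripm P Q = ripm Q P.
Proof. by have [[_ _ h _] _] := ipm_metrizes; rewrite /ripm h. Qed.

Lemma ripm_tri P Q S : ripm P S <= ripm P Q + ripm Q S.
Proof. by have [[_ _ _ h] _] := ipm_metrizes; rewrite -lee_fin EFinD !ripmE. Qed.

Lemma ripm_ge0 P Q : 0 <= ripm P Q.
Proof.
have [[h _ _ _] _] := ipm_metrizes; have /andP[h0 h1] := h P Q.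
by rewrite /ripm fine_ge0.
Qed.

Lemma ripm_cvg (P_ : nat -> prob R X) P :
  (ripm (P_ n) P @[n --> \oo] --> 0) <-> (P_ n @[n --> \oo] --> P).
Proof.
rewrite -(ipm_metrizes.2 P_ P); split => h.
  by apply/fine_cvgP; split => //; apply: nearW => n; rewrite -ripmE.
by have /fine_cvgP[] := h.
Qed.

Lemma mdist_bounded (a : nat -> X) j : exists M : R, forall x, `|mdist (a j) x| <= M.
Proof.
by have [M XM] := diamX; exists M => x; rewrite ger0_norm ?mdist_ge0.
Qed.

(** The hypothesis on the integral probability metric only concerns sequences;
    first countability of the weak topology upgrades it to neighbourhoods. *)
Lemma ripm_nbhs (P : prob R X) (A : set (prob R X)) : nbhs P A <->
  exists2 r : R, 0 < r & forall Q, ripm P Q < r -> A Q.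
Proof.
have [a agen] := metric_space_generates sepX.
apply: (sequential_metric_nbhs (cone_laplace_generates agen (mdist_bounded a))).
- exact: ripmC.
- exact: ripm_cvg.
- exact: ripm_ge0.
Qed.

Lemma wasserstein_ipm_metrizes : metrizes_weak (wasserstein_ipm F).
Proof.
have [a agen] := metric_space_generates sepX.
have [b bdense] := generates_dense (cone_laplace_generates agen (mdist_bounded a)).
have [M FM] := ipm_bounded.
have rM P Q : ripm P Q <= M by rewrite -lee_fin ripmE.
have := wasserstein_metrizes ripm_refl ripmC ripm_tri rM ripm_nbhs bdense.
congr (metrizes_weak _); apply/funext => Q1; apply/funext => Q2.
congr (transport _ _ _); apply/funext => P; apply/funext => Q.
exact: ripmE.
Qed.

Lemma ipm_measurable : measurable_fun setT
  (fun z : borel (prob R X) * borel (prob R X) => ipm F z.1 z.2).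
Proof.
have [a agen] := metric_space_generates sepX.
have [b bdense] := generates_dense (cone_laplace_generates agen (mdist_bounded a)).
have [M FM] := ipm_bounded.
have rM P Q : ripm P Q <= M by rewrite -lee_fin ripmE.
have /measurable_EFinP :=
  metric_measurable ripm_refl ripmC ripm_tri rM ripm_nbhs bdense.
rewrite (_ : EFin \o _ = (fun z => ipm F z.1 z.2))//.
by apply/funext => z; exact: ripmE.
Qed.

Lemma ipm_ge (f : X -> R) (P Q : prob R X) : F f ->
  `|\int[P]_x f x - \int[Q]_x f x| <= ripm P Q.
Proof. by move=> Ff; rewrite -lee_fin ripmE; apply: le_supremum0; exists f. Qed.

End ipm.

(** * Uniform closure of a function algebra *)

Section uniform_closure.
Context (R : realType) (S : Type).
Variable A : (S -> R) -> Prop.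
Hypotheses (AD : forall f g, A f -> A g -> A (fun x => f x + g x))
  (AZ : forall a f, A f -> A (fun x => a * f x))
  (AM : forall f g, A f -> A g -> A (fun x => f x * g x))
  (Ab : forall f, A f -> exists M : R, forall x, `|f x| <= M).

Definition uclosure (f : S -> R) :=
  forall eps : R, 0 < eps -> exists2 g, A g & forall x, `|f x - g x| <= eps.

Lemma uclosure_sub f : A f -> uclosure f.
Proof. by move=> Af eps eps0; exists f => // x; rewrite subrr normr0 ltW. Qed.

Lemma uclosureD f g : uclosure f -> uclosure g -> uclosure (fun x => f x + g x).
Proof.
move=> cf cg eps eps0; have eps2 : 0 < eps / 2 by rewrite divr_gt0.
have [f' Af' ff'] := cf _ eps2; have [g' Ag' gg'] := cg _ eps2.
exists (fun x => f' x + g' x) => [|x]; first exact: AD.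
rewrite opprD addrACA (le_trans (ler_normD _ _))// [leRHS]splitr.
exact: lerD.
Qed.

Lemma uclosureZ a f : uclosure f -> uclosure (fun x => a * f x).
Proof.
move=> cf eps eps0; have a1 : 0 < `|a| + 1 by rewrite ltr_wpDl.
have [|g Ag fg] := cf (eps / (`|a| + 1)); first by rewrite divr_gt0.
exists (fun x => a * g x) => [|x]; first exact: AZ.
rewrite -mulrBr normrM (@le_trans _ _ (`|a| * (eps / (`|a| + 1))))//.
  exact: ler_wpM2l.
rewrite mulrCA ler_piMr//; first exact: ltW.
by rewrite ler_pdivrMr// mul1r lerDl.
Qed.

(** The classical recursion for polynomials increasing to [|t|] on [[-1, 1]]. *)
Fixpoint abs_poly (n : nat) (t : R) : R :=
  if n is m.+1 then
    abs_poly m t + (t * t - abs_poly m t * abs_poly m t) / 2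
  else 0.

(** With [s = |t|], one step multiplies the error [s - p] by
    [1 - (s + p) / 2 <= 1 - s / 2], and [(1 - x) (1 + (n + 1) x) <= 1 + n x];
    the stated form of the bound is the one preserved by this step. *)
Lemma abs_poly_bounds n t : `|t| <= 1 ->
  0 <= abs_poly n t <= `|t| /\
  (`|t| - abs_poly n t) * (1 + n%:R * (`|t| / 2)) <= `|t|.
Proof.
move=> t1; have tt : t * t = `|t| * `|t|.
  by rewrite -normrM ger0_norm// -expr2 sqr_ge0.
have t0 : 0 <= `|t| by [].
elim: n => [|n [/andP[p0 pt] pn]] /=.
  by rewrite lexx t0 subr0 mul0r addr0 mulr1.
rewrite tt; move: (abs_poly n t) p0 pt pn; move: (`|t|) t0 t1 => s s0 s1 p p0 ps pn.
have step : s - (p + (s * s - p * p) / 2) = (s - p) * (1 - (s + p) / 2) by field.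
split; first by apply/andP; split; nra.
rewrite step -[n.+1%:R]natr1; move: (n%:R : R) (ler0n R n) pn => k k0 pn.
have sp0 : 0 <= s - p by lra.
apply: le_trans pn.
rewrite -mulrA ler_wpM2l//.
have : (1 - (s + p) / 2) * (1 + (k + 1) * (s / 2)) <=
    (1 - s / 2) * (1 + (k + 1) * (s / 2)).
  rewrite ler_wpM2r//; last lra.
  by rewrite addr_ge0// mulr_ge0; lra.
by move=> /le_trans; apply; nra.
Qed.

Lemma abs_poly_cvg n t : `|t| <= 1 -> `| `|t| - abs_poly n.+1 t| <= 2 / n.+1%:R.
Proof.
move=> t1; have [/andP[p0 pt] pn] := abs_poly_bounds n.+1 t1.
rewrite ger0_norm ?subr_ge0// ler_pdivlMr//.
have [t0|t0] := eqVneq `|t| 0.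
  have : `|t| - abs_poly n.+1 t <= 0 by rewrite t0 subr_le0.
  by move=> h; apply: (@le_trans _ _ 0) => //; rewrite mulr_le0_ge0.
have {t0} : 0 < `|t| by rewrite lt_def t0 normr_ge0.
move: (abs_poly n.+1 t) p0 pt pn; move: `|t| t1 (n.+1%:R : R) => s s1 k p p0 ps pn s0.
have : (s - p) * (k * (s / 2)) <= s by nra.
rewrite [leLHS](_ : _ = (s - p) * k / 2 * s); last by field.
by rewrite -[leRHS]mul1r ler_pM2r// ler_pdivrMr// mul1r.
Qed.

Lemma algebra_abs_poly f n : A f -> A (fun x => abs_poly n (f x)).
Proof.
move=> Af; elim: n => [|n IH] /=.
  rewrite (_ : (fun=> 0) = fun x => 0 * f x); first exact: AZ.
  by apply/funext => x; rewrite mul0r.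
apply: AD => //; under eq_fun do rewrite mulrC.
apply: AZ; apply: AD; first exact: AM.
by under eq_fun do rewrite -mulN1r; apply: AZ; exact: AM.
Qed.

(** The step of the Stone-Weierstrass theorem that turns an algebra into a
    lattice: as [g] is bounded, [|g|] is a uniform limit of polynomials in
    [g]. *)
Lemma uclosure_norm f : uclosure f -> uclosure (fun x => `|f x|).
Proof.
move=> cf eps eps0; have eps2 : 0 < eps / 2 by rewrite divr_gt0.
have [g Ag fg] := cf _ eps2; have [M gM] := Ab Ag.
pose K := `|M| + 1; have K0 : 0 < K by rewrite ltr_wpDl.
have gK x : `|K^-1 * g x| <= 1.
  rewrite normrM gtr0_norm ?invr_gt0// ler_pdivrMl// mulr1 (le_trans (gM x))//.
  by rewrite (le_trans (ler_norm _))// lerDl.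
pose n := Num.bound (2 * K / (eps / 2)).
have nK : 2 * K / (eps / 2) < n.+1%:R.
  apply: (@lt_trans _ _ n%:R); last by rewrite ltr_nat.
  by apply: archi_boundP; rewrite divr_ge0 ?mulr_ge0// ltW.
exists (fun x => K * abs_poly n.+1 (K^-1 * g x)) => [|x].
  by apply: AZ; apply: (algebra_abs_poly (f := fun x => K^-1 * g x)); exact: AZ.
have -> : `|f x| - K * abs_poly n.+1 (K^-1 * g x) =
    (`|f x| - `|g x|) + K * (`|K^-1 * g x| - abs_poly n.+1 (K^-1 * g x)).
  rewrite normrM gtr0_norm ?invr_gt0// mulrBr mulrA divff ?gt_eqF// mul1r.
  by rewrite addrA subrK.
rewrite (le_trans (ler_normD _ _))// [leRHS]splitr lerD//.
  exact: le_trans (ler_dist_dist _ _) (fg x).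
rewrite normrM gtr0_norm// -ler_pdivlMl//.
apply: (le_trans (abs_poly_cvg _ (gK x))).
rewrite [leRHS]mulrC ler_pdivlMr// mulrAC ler_pdivrMr// [leRHS]mulrC ltW//.
by rewrite -ltr_pdivrMr.
Qed.

End uniform_closure.

(** * The algebra of Laplace functionals on a space of probability measures *)

Lemma CbD (R : realType) (T : ptopologicalType) (f g : T -> R) :
  Cb R T f -> Cb R T g -> Cb R T (fun x => f x + g x).
Proof.
move=> [cf /bounded_funP[M fM]] [cg /bounded_funP[N gN]]; split.
  by move=> x; apply: cvgD; [exact: cf | exact: cg].
by apply/bounded_funP; exists (M + N) => x; rewrite (le_trans (ler_normD _ _))// lerD.
Qed.

Section laplace.
Context (R : realType) (X : ptopologicalType).

Inductive laplace : (prob R X -> R) -> Prop :=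
| laplace_exp g : Cb R X g -> (forall x, 0 <= g x) ->
    laplace (fun P => expR (- \int[P]_x g x))
| laplaceD f g : laplace f -> laplace g -> laplace (fun P => f P + g P)
| laplaceZ a f : laplace f -> laplace (fun P => a * f P).

(** [exp (- P(h)) exp (- P(k)) = exp (- P(h + k))], extended bilinearly. *)
Lemma laplaceM f g : laplace f -> laplace g -> laplace (fun P => f P * g P).
Proof.
elim=> [h Ch h0|f1 f2 _ IH1 _ IH2|a f1 _ IH] lg; last 2 first.
- by under eq_fun do rewrite mulrDl; apply: laplaceD; [exact: IH1 | exact: IH2].
- by under eq_fun do rewrite -mulrA; apply: laplaceZ; exact: IH.
elim: lg => [k Ck k0|g1 g2 _ IH1 _ IH2|a g1 _ IH].
- rewrite (_ : (fun P => _) = (fun P : prob R X => expR (- \int[P]_x (h x + k x)))).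
    by apply: laplace_exp => [|x]; [exact: CbD | rewrite addr_ge0].
  by apply/funext => P; rewrite -expRD -opprD intD//; exact: Cb_bmeas.
- by under eq_fun do rewrite mulrDr; exact: laplaceD.
- by under eq_fun do rewrite mulrCA; exact: laplaceZ.
Qed.

Lemma laplace1 : laplace (fun=> 1).
Proof.
rewrite (_ : (fun=> 1) = (fun P : prob R X => expR (- \int[P]_x 0))).
  apply: laplace_exp => //; split; first by move=> x; exact: cvg_cst.
  by apply/bounded_funP; exists 0 => x; rewrite normr0.
by apply/funext => P; rewrite int_cst oppr0 expR0.
Qed.

Lemma laplace_Cb f : laplace f -> Cb R (prob R X) f.
Proof.
elim=> [g Cg g0|f1 f2 _ C1 _ C2|a f1 _ [c1 /bounded_funP[M fM]]].
- split; first move=> P.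
    apply: continuous_comp; last exact: continuous_expR.
    by apply: continuousN; exact: int_continuous.
  apply/bounded_funP; exists 1 => P; rewrite ger0_norm ?expR_ge0//.
  by rewrite -expR0 ler_expR oppr_le0 int_ge0.
- exact: CbD.
- split; first by move=> P; exact: (cvgM (cvg_cst a) (c1 P)).
  by apply/bounded_funP; exists (`|a| * M) => x; rewrite normrM ler_wpM2l.
Qed.

End laplace.

(** * The Wasserstein distance of bounded laws on the line *)

Section bounded_laws.
Context (R : realType) (K : R) (K0 : 0 <= K).

Definition clamp (x : R) := Num.max (- K) (Num.min K x).

(** A bounded pseudometric on the line that agrees with the usual distance on
    [[-K, K]]. *)
Definition clamp_dist (x y : R) := `|clamp x - clamp y|.

Lemma clamp_id x : `|x| <= K -> clamp x = x.
Proof.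
by rewrite ler_norml /clamp => /andP[xl xr]; rewrite (min_idPr xr) (max_idPr xl).
Qed.

Lemma clamp_bound x : `|clamp x| <= K.
Proof.
by rewrite /clamp ler_norml le_max lexx/= ge_max ge_min lexx/= andbT ge0_cp.
Qed.

Lemma clamp_dist_le x y : clamp_dist x y <= `|x - y|.
Proof.
have max_dist (c u v : R) : `|Num.max c u - Num.max c v| <= `|u - v|.
  have h1 := ler_norm (u - v); have h2 := ler_norm (v - u); rewrite distrC in h2.
  by case: (leP c u) => ?; case: (leP c v) => ?; rewrite ler_norml;
    apply/andP; split; lra.
have min_dist (c u v : R) : `|Num.min c u - Num.min c v| <= `|u - v|.
  have h1 := ler_norm (u - v); have h2 := ler_norm (v - u); rewrite distrC in h2.
  by case: (leP c u) => ?; case: (leP c v) => ?; rewrite ler_norml;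
    apply/andP; split; lra.
exact: le_trans (max_dist _ _ _) (min_dist _ _ _).
Qed.

Lemma measurable_clamp : measurable_fun setT clamp.
Proof. by apply: measurable_maxr => //; exact: measurable_minr. Qed.

Let measurable_absdiff :
  measurable_fun setT (fun z : R * R => (`|z.1 - z.2|)%:E).
Proof.
apply/measurable_EFinP; apply: measurableT_comp => //.
by apply: measurable_funB; [exact: measurable_fst | exact: measurable_snd].
Qed.

Let measurable_clamp_dist :
  measurable_fun setT (fun z : R * R => (clamp_dist z.1 z.2)%:E).
Proof.
apply/measurable_EFinP; apply: measurableT_comp => //; apply: measurable_funB.
- by apply: measurableT_comp; [exact: measurable_clamp | exact: measurable_fst].
- by apply: measurableT_comp; [exact: measurable_clamp | exact: measurable_snd].
Qed.

(** Invariance under clamping: [mu] is carried by [[-K, K]]. *)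
Definition clamped (mu : set R -> \bar R) :=
  forall A, measurable A -> mu (clamp @^-1` A) = mu A.

(** Clamping both coordinates of a coupling leaves its marginals unchanged and
    makes the two costs equal. *)
Lemma wasserstein1_clamped (mu nu : set R -> \bar R) : clamped mu -> clamped nu ->
  wasserstein1 mu nu = transport (fun x y => (clamp_dist x y)%:E) mu nu.
Proof.
move=> cmu cnu; apply: le_anti; apply/andP; split; apply: transport_lb => g [g1 g2].
  have mcc : measurable_fun setT (fun z : R * R => (clamp z.1, clamp z.2)).
    apply: measurable_fun_pair.
    - by apply: measurableT_comp; [exact: measurable_clamp | exact: measurable_fst].
    - by apply: measurableT_comp; [exact: measurable_clamp | exact: measurable_snd].
  have mcA A : measurable A -> measurable (clamp @^-1` A).
    by move=> mA; rewrite -[X in measurable X]setTI; exact: measurable_clamp.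
  have [g' g'E] := prob_pushforward g mcc.
  rewrite /wasserstein1.
  have g'C : couplings mu nu g'.
    split=> A mA; rewrite /pushforward g'E.
      by rewrite -(cmu A mA) -(g1 _ (mcA _ mA)).
    by rewrite -(cnu A mA) -(g2 _ (mcA _ mA)).
  apply: (@le_trans _ _ (\int[g']_z (`|z.1 - z.2|)%:E)%E).
    exact: (transport_le (fun x y : R => (`|x - y|)%:E) g'C).
  by rewrite (ge0_integral_image (P := g) (h := fun z => (clamp z.1, clamp z.2))
    (f := fun z => (`|z.1 - z.2|)%:E)).
apply: (le_trans (transport_le (g := g) (fun x y => (clamp_dist x y)%:E) _)) => //.
apply: ge0_le_integral => // z _; rewrite lee_fin.
- exact: normr_ge0.
- exact: clamp_dist_le.
Qed.

Lemma wasserstein1_triangle (P : probability R R) (mu nu : set R -> \bar R) :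
  clamped mu -> clamped P -> clamped nu ->
  (wasserstein1 mu nu <= wasserstein1 mu P + wasserstein1 P nu)%E.
Proof.
move=> cmu cP cnu; rewrite !wasserstein1_clamped//.
apply: (@transport_triangle _ _ R clamp_dist (K + K)
  (fun n => if unpickle n is Some q then ratr q else 0)).
- by move=> x; rewrite /clamp_dist subrr normr0.
- by move=> x y; rewrite /clamp_dist distrC.
- by move=> x y z; exact: ler_distD.
- move=> x y; rewrite /clamp_dist (le_trans (ler_normB _ _))//.
  by rewrite lerD// clamp_bound.
- move=> x; apply: measurableT_comp => //; apply: measurable_funB => //.
  exact: measurable_clamp.
- move=> x r r0; have [q] := @rat_in_itvoo R (x - r) (x + r) ltac:(lra).
  rewrite in_itv/= => /andP[h1 h2]; exists (pickle q); rewrite pickleK.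
  apply: (le_lt_trans (clamp_dist_le _ _)).
  by rewrite ltr_distl h1 h2.
Qed.

Lemma wasserstein1_lipschitz (P Q : probability R R) (h : R -> R) (L : R) :
  bmeas h -> 0 < L -> (forall x y, `|h x - h y| <= L * `|x - y|) ->
  ((`|\int[P]_x h x - \int[Q]_x h x|)%:E <= L%:E * wasserstein1 P Q)%E.
Proof.
move=> bh L0 hL.
apply: (@transport_lipschitz _ _ R (fun x y => `|x - y|)) => //.
exact/measurable_EFinP.
Qed.

End bounded_laws.

Lemma wasserstein1_ge0 (R : realType) (mu nu : set R -> \bar R) :
  (0 <= wasserstein1 mu nu)%E.
Proof. by apply: transport_ge0 => x y; rewrite lee_fin. Qed.

Lemma wasserstein1_sym (R : realType) (mu nu : set R -> \bar R) :
  wasserstein1 mu nu = wasserstein1 nu mu.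
Proof.
have mabs : measurable_fun setT (fun z : R * R => (`|z.1 - z.2|)%:E).
  apply/measurable_EFinP; apply: measurableT_comp => //.
  by apply: measurable_funB; [exact: measurable_fst | exact: measurable_snd].
by apply: le_anti; apply/andP; split; apply: transport_sym => // x y; rewrite distrC.
Qed.

(** * The hierarchical integral probability metric *)

Section hipm.
Context (R : realType) (X : completeMetricType R).
Hypotheses (sepX : separable X) (diamX : bounded_diameter X).
Variable F : set (X -> R).
Hypotheses (F_measurable : forall f, F f -> measurable_fun [set: borel X] f)
    (F_bounded : forall f, F f -> bounded_fun f)
    (ipm_bounded : exists M : R, forall P1 P2 : prob R X,
       (ipm F P1 P2 <= M%:E)%E)
    (ipm_metrizes : metrizes_weak (ipm F)).

Let F_bmeas f : F f -> bmeas (f : borel X -> R).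
Proof. by move=> Ff; split; [exact: F_measurable | exact/bounded_funP/F_bounded]. Qed.

Let mean (f : X -> R) (P : borel (prob R X)) : R := \int[(P : prob R X)]_x f x.

(** [|P(f) - Q(f)|] is at most the integral probability metric, so [P |-> P(f)]
    is weakly continuous even when [f] is only measurable. *)
Lemma mean_continuous f : F f -> continuous (mean f : prob R X -> R).
Proof.
move=> Ff P; have FP := @nbhs_filter (prob R X) P.
apply/cvgrPdist_lt => r r0.
apply/(ripm_nbhs sepX diamX ipm_metrizes); exists r => // Q PQ.
exact: le_lt_trans (ipm_ge ipm_metrizes P Q Ff) PQ.
Qed.

Lemma mean_bmeas f : F f -> bmeas (mean f).
Proof.
move=> Ff; apply: (@Cb_bmeas _ (prob R X)); split; first exact: mean_continuous.
have [_ [M fM]] := F_bmeas Ff; apply/bounded_funP; exists M => P.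
exact: (int_norm_le (P : prob R X) (F_bmeas Ff) fM).
Qed.

Lemma mean_law_prob f (Q : prob R (prob R X)) : F f ->
  exists P : probability R R, (P : set R -> \bar R) = mean_law Q f.
Proof.
move=> Ff; have [P PE] := prob_pushforward Q (mean_bmeas Ff).1.
by exists P; apply/funext => A; rewrite PE.
Qed.

Lemma mean_law_clamped f : F f -> exists2 K : R, 0 <= K &
  forall Q, clamped K (mean_law Q f).
Proof.
move=> Ff; have [_ [K fK]] := F_bmeas Ff.
have K0 : 0 <= K by exact: le_trans (fK point).
exists K => // Q A mA; rewrite /mean_law /pushforward; congr (Q _).
apply/seteqP; split => P /=; rewrite clamp_id//;
  exact: (int_norm_le (P : prob R X) (F_bmeas Ff) fK).
Qed.

(** A coupling of [Q1] and [Q2] induces one of the laws of the means, and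
    [|P1(f) - P2(f)|] is at most the integral probability metric. *)
Lemma mean_law_wasserstein_le f (Q1 Q2 : prob R (prob R X)) : F f ->
  (wasserstein1 (mean_law Q1 f) (mean_law Q2 f) <= wasserstein_ipm F Q1 Q2)%E.
Proof.
move=> Ff; apply: transport_lb => g [g1 g2].
have mf := (mean_bmeas Ff).1.
pose h (z : borel (prob R X) * borel (prob R X)) := (mean f z.1, mean f z.2).
have mh : measurable_fun setT h.
  apply: measurable_fun_pair.
  - by apply: measurableT_comp => //; exact: measurable_fst.
  - by apply: measurableT_comp => //; exact: measurable_snd.
have [g' g'E] := prob_pushforward g mh.
have mfA A : measurable A -> measurable (mean f @^-1` A).
  by move=> mA; rewrite -[X in measurable X]setTI; exact: mf.
rewrite /wasserstein1.
have g'C : couplings (mean_law Q1 f) (mean_law Q2 f) g'.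
  split=> A mA; rewrite /pushforward g'E.
    by rewrite /mean_law /pushforward -(g1 _ (mfA _ mA)).
  by rewrite /mean_law /pushforward -(g2 _ (mfA _ mA)).
apply: (@le_trans _ _ (\int[g']_z (`|z.1 - z.2|)%:E)%E).
  exact: (transport_le (fun x y : R => (`|x - y|)%:E) g'C).
have mabs : measurable_fun setT (fun z : R * R => (`|z.1 - z.2|)%:E).
  apply/measurable_EFinP; apply: measurableT_comp => //.
  by apply: measurable_funB; [exact: measurable_fst | exact: measurable_snd].
rewrite (ge0_integral_image (P := g) (h := h) (f := fun z => (`|z.1 - z.2|)%:E))//.
apply: ge0_le_integral => //.
- exact: (measurableT_comp mabs mh).
- exact: (ipm_measurable sepX diamX ipm_bounded ipm_metrizes).
- by move=> z _; rewrite -(ripmE ipm_metrizes) lee_fin; exact: ipm_ge.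
Qed.

Lemma hipm_ge0 Q1 Q2 : (0 <= hipm F Q1 Q2)%E.
Proof. by apply: supremum0_ge0 => _ [f _ <-]; exact: wasserstein1_ge0. Qed.

Lemma hipm_ge f Q1 Q2 : F f ->
  (wasserstein1 (mean_law Q1 f) (mean_law Q2 f) <= hipm F Q1 Q2)%E.
Proof. by move=> Ff; apply: le_supremum0; exists f. Qed.

Lemma hipm_le_wasserstein Q1 Q2 : (hipm F Q1 Q2 <= wasserstein_ipm F Q1 Q2)%E.
Proof.
apply: supremum0_le => [|_ [f Ff <-]]; last exact: mean_law_wasserstein_le.
have [[h _ _ _] _] :=
  wasserstein_ipm_metrizes sepX diamX ipm_bounded ipm_metrizes.
by have /andP[] := h Q1 Q2.
Qed.

Lemma hipm_sym Q1 Q2 : hipm F Q1 Q2 = hipm F Q2 Q1.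
Proof.
rewrite /hipm; congr (supremum _ _); apply/seteqP.
by split => _ [f Ff <-]; exists f => //; rewrite wasserstein1_sym.
Qed.

Lemma hipm_triangle Q1 Q2 Q3 : (hipm F Q1 Q3 <= hipm F Q1 Q2 + hipm F Q2 Q3)%E.
Proof.
apply: supremum0_le => [|_ [f Ff <-]]; first by rewrite adde_ge0// hipm_ge0.
have [K K0 cK] := mean_law_clamped Ff.
have [P PE] := mean_law_prob Q2 Ff.
apply: (@le_trans _ _
  (wasserstein1 (mean_law Q1 f) P + wasserstein1 P (mean_law Q3 f))%E).
  by apply: (wasserstein1_triangle K0) => //; rewrite PE.
by rewrite PE leeD// hipm_ge.
Qed.

End hipm.

Lemma dist_le_thirds (R : realType) (x x' y y' eps : R) :
  `|x - x'| <= eps / 3 -> `|y - y'| <= eps / 3 -> `|y' - x'| <= eps / 3 ->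
  `|x - y| <= eps.
Proof.
rewrite !ler_norml => /andP[? ?] /andP[? ?] /andP[? ?].
by apply/andP; split; lra.
Qed.

Lemma dist_expR_neg_max (R : realType) (x y : R) :
  `|expR (- Num.max 0 x) - expR (- Num.max 0 y)| <= `|x - y|.
Proof.
have mono (s t : R) : 0 <= s -> s <= t -> `|expR (- s) - expR (- t)| <= t - s.
  move=> s0 st; rewrite ger0_norm ?subr_ge0 ?ler_expR ?lerN2//.
  have -> : expR (- t) = expR (- s) * expR (- (t - s)) by rewrite -expRD; congr expR; lra.
  have h1 : expR (- s) <= 1 by rewrite -expR0 ler_expR oppr_le0.
  have h2 : 1 + (- (t - s)) <= expR (- (t - s)) by exact: expR_ge1Dx.
  have h3 := expR_ge0 (- s).
  have h4 : expR (- (t - s)) <= 1 by rewrite -expR0 ler_expR oppr_le0 subr_ge0.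
  nra.
have max_dist (u v : R) : `|Num.max 0 u - Num.max 0 v| <= `|u - v|.
  have h1 := ler_norm (u - v); have h2 := ler_norm (v - u); rewrite distrC in h2.
  by case: (leP 0 u) => ?; case: (leP 0 v) => ?; rewrite ler_norml;
    apply/andP; split; lra.
apply: le_trans (max_dist x y).
have x0 : 0 <= Num.max 0 x by rewrite le_max lexx.
have y0 : 0 <= Num.max 0 y by rewrite le_max lexx.
have [xy|/ltW yx] := leP (Num.max 0 x) (Num.max 0 y).
  by rewrite (distrC (Num.max 0 x)) [leRHS]ger0_norm ?subr_ge0//; exact: mono.
by rewrite distrC [leRHS]ger0_norm ?subr_ge0//; exact: mono.
Qed.

Section hipm_dense.
Context (R : realType) (X : completeMetricType R).
Hypotheses (sepX : separable X) (diamX : bounded_diameter X).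
Variable F : set (X -> R).
Hypotheses (F_measurable : forall f, F f -> measurable_fun [set: borel X] f)
    (F_bounded : forall f, F f -> bounded_fun f)
    (ipm_bounded : exists M : R, forall P1 P2 : prob R X,
       (ipm F P1 P2 <= M%:E)%E)
    (ipm_metrizes : metrizes_weak (ipm F)).
Hypothesis F_dense : affine_dense F.

Variables (Q_ : nat -> prob R (prob R X)) (Q : prob R (prob R X)).
Hypothesis hipm_cvg0 : hipm F (Q_ n) Q @[n --> \oo] --> 0%E.

Let F_bmeas f : F f -> bmeas (f : borel X -> R).
Proof. by move=> Ff; split; [exact: F_measurable | exact/bounded_funP/F_bounded]. Qed.

(** Approximate [g] uniformly by [a f + b]; as [P(g) >= 0], [exp (- P(g))] is
    uniformly close to [h (P(f))] with [h x = exp (- max 0 (a x + b))] bounded and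
    Lipschitz, and the integral of [h (P(f))] depends only on the law of
    [P(f)]. *)
Lemma hipm_cvg_exp (g : X -> R) : Cb R X g -> (forall x, 0 <= g x) ->
  \int[Q_ n]_P expR (- \int[(P : prob R X)]_x g x) @[n --> \oo] -->
  (\int[Q]_P expR (- \int[(P : prob R X)]_x g x) : R).
Proof.
move=> Cg g0; pose E (P : prob R X) := expR (- \int[P]_x g x).
have bE : bmeas (E : borel (prob R X) -> R).
  exact: Cb_bmeas (laplace_Cb (laplace_exp Cg g0)).
apply/cvgrPdist_le => eps eps0.
have eps3 : 0 < eps / 3 by rewrite divr_gt0.
have [f [a [b [Ff fg]]]] := F_dense Cg eps3.
have bf := F_bmeas Ff.
have mf := mean_bmeas sepX diamX F_measurable F_bounded ipm_metrizes Ff.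
pose h (x : R) := expR (- Num.max 0 (a * x + b)).
have h01 x : 0 <= h x <= 1.
  by rewrite expR_ge0/= -expR0 ler_expR oppr_le0 le_max lexx.
have bh : bmeas h.
  split; last by exists 1 => x; have /andP[? ?] := h01 x; rewrite ger0_norm.
  apply: measurableT_comp => //; apply: measurable_funN; apply: measurable_maxr => //.
  by apply: measurable_funD => //; exact: measurable_funM.
pose L := `|a| + 1; have L0 : 0 < L by rewrite ltr_wpDl.
have hL x y : `|h x - h y| <= L * `|x - y|.
  apply: (le_trans (dist_expR_neg_max _ _)).
  rewrite (_ : a * x + b - (a * y + b) = a * (x - y)); last by ring.
  by rewrite normrM ler_wpM2r// lerDl.
pose k (P : prob R X) := h (\int[P]_x f x).
have bk : bmeas (k : borel (prob R X) -> R).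
  by apply: (bmeas_comp (f := h)) => //; exact: mf.1.
have Ek (P : prob R X) : `|E P - k P| <= eps / 3.
  have Eg : 0 <= \int[P]_x g x by exact: int_ge0.
  rewrite /E -[X in expR (- X)](max_idPr Eg) (le_trans (dist_expR_neg_max _ _))//.
  have -> : a * \int[P]_x f x + b = \int[P]_x (a * f x + b).
    by rewrite intD ?intZ ?int_cst//; [exact: bmeasZ | exact: bmeas_cst].
  apply: int_dist_le => [||x]; first exact: Cb_bmeas.
    by apply: bmeasD; [exact: bmeasZ | exact: bmeas_cst].
  by rewrite distrC.
have intk (S : prob R (prob R X)) (P : probability R R) :
    (P : set R -> \bar R) = mean_law S f -> \int[S]_V k V = \int[P]_x h x.
  move=> PS; rewrite (int_image (P := S) (P' := P)
    (h := fun V : borel (prob R X) => \int[(V : prob R X)]_x f x))//.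
    exact: mf.1.
  by move=> A mA; rewrite PS.
have kL n : (`|\int[Q_ n]_V k V - \int[Q]_V k V|%:E <= L%:E * hipm F (Q_ n) Q)%E.
  have [P PE] := mean_law_prob sepX diamX F_measurable F_bounded ipm_metrizes (Q_ n) Ff.
  have [P' PE'] := mean_law_prob sepX diamX F_measurable F_bounded ipm_metrizes Q Ff.
  rewrite (intk _ _ PE) (intk _ _ PE').
  apply: (le_trans (wasserstein1_lipschitz P P' bh L0 hL)).
  rewrite lee_pmul2l//; first by rewrite PE PE'; exact: hipm_ge.
have /fine_cvgP[hfin /cvgrPdist_lt/(_ (eps / (3 * L)))] := hipm_cvg0.
rewrite divr_gt0 ?mulr_gt0// => /(_ isT); move: hfin; apply: filterS2 => n fn /=.
rewrite sub0r normrN => hn.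
have := kL n; rewrite -(fineK fn) -EFinM lee_fin => kn.
have Eint (S : prob R (prob R X)) : `|\int[S]_V E V - \int[S]_V k V| <= eps / 3.
  exact: int_dist_le.
have h1 := Eint Q; have h2 := Eint (Q_ n).
have h3 : L * fine (hipm F (Q_ n) Q) <= eps / 3.
  rewrite -ler_pdivlMl// (le_trans (ler_norm _))// (le_trans (ltW hn))//.
  by rewrite invfM mulrA mulrC.
exact: dist_le_thirds h1 h2 (le_trans kn h3).
Qed.

Lemma hipm_cvg_laplace (u : prob R X -> R) : laplace u ->
  \int[Q_ n]_P u P @[n --> \oo] --> (\int[Q]_P u P : R).
Proof.
have lb v : laplace v -> bmeas (v : borel (prob R X) -> R).
  by move=> lv; exact: Cb_bmeas (laplace_Cb lv).
elim=> [g Cg g0|f1 f2 l1 IH1 l2 IH2|a f1 l1 IH1].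
- exact: hipm_cvg_exp.
- rewrite intD; [|exact: lb|exact: lb].
  under eq_fun do (rewrite intD; [|exact: lb|exact: lb]).
  exact: cvgD.
- rewrite intZ; last exact: lb.
  under eq_fun do (rewrite intZ; last exact: lb).
  by apply: cvgM => //; exact: cvg_cst.
Qed.

(** Weak convergence is tested on the lattice spanned by the generators of the
    weak topology, which lies in the uniform closure of the Laplace
    functionals. *)
Lemma hipm_cvg_weak : Q_ n @[n --> \oo] --> Q.
Proof.
have [a agen] := metric_space_generates sepX.
have ab := mdist_bounded diamX a.
have egen := cone_laplace_generates agen ab.
have ebounded j : exists M : R, forall P : prob R X,
    `|cone_laplace (fun j : nat => mdist (a j)) j P| <= M.
  exists 1 => P; rewrite ger0_norm ?expR_ge0// -expR0 ler_expR oppr_le0.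
  by apply: int_ge0 => x; exact: cone_max_ge0.
apply: (lattice_cvg egen ebounded) => u lu.
have bu := lattice_bmeas egen ebounded lu.
have clu : uclosure (@laplace R X) u.
  have lb (v : prob R X -> R) : laplace v -> exists M : R, forall P, `|v P| <= M.
    by move=> /laplace_Cb[_ /bounded_funP].
  have AD := @laplaceD R X.
  have AZ := @laplaceZ R X; have AM := @laplaceM R X.
  elim: lu => [b|j|f g _ cf _ cg|b f _ cf|f _ cf].
  - apply: uclosure_sub; rewrite (_ : (fun=> b) = fun P : prob R X => b * 1).
      by apply: laplaceZ; exact: laplace1.
    by apply/funext => P; rewrite mulr1.
  - apply: uclosure_sub; apply: laplace_exp.
      exact: (lattice_Cb agen ab (lattice_cone_max _ _)).
    by move=> x; exact: cone_max_ge0.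
  - exact: uclosureD.
  - exact: uclosureZ.
  - exact: uclosure_norm.
apply/cvgrPdist_le => eps eps0.
have eps3 : 0 < eps / 3 by rewrite divr_gt0.
have [v lv uv] := clu _ eps3.
have bv : bmeas (v : borel (prob R X) -> R).
  exact: Cb_bmeas (laplace_Cb lv).
have Eint (S : prob R (prob R X)) : `|\int[S]_V u V - \int[S]_V v V| <= eps / 3.
  exact: int_dist_le.
have /cvgrPdist_le/(_ _ eps3) := hipm_cvg_laplace lv.
apply: filterS => n; rewrite distrC.
exact: dist_le_thirds (Eint Q) (Eint (Q_ n)).
Qed.

End hipm_dense.

Section hipm_metrizes.
Context (R : realType) (X : completeMetricType R).
Hypotheses (sepX : separable X) (diamX : bounded_diameter X).
Variable F : set (X -> R).
Hypotheses (F_measurable : forall f, F f -> measurable_fun [set: borel X] f)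
    (F_bounded : forall f, F f -> bounded_fun f)
    (ipm_bounded : exists M : R, forall P1 P2 : prob R X,
       (ipm F P1 P2 <= M%:E)%E)
    (ipm_metrizes : metrizes_weak (ipm F)).

(** Definiteness follows from the convergence statement along the constant
    sequence [Q1]: it converges weakly to [Q2], hence their Wasserstein distance
    is zero. *)
Lemma hipm_metrizes : affine_dense F -> metrizes_weak (hipm F).
Proof.
move=> F_dense.
have [[Wfin W0 _ _] Wcvg] :=
  wasserstein_ipm_metrizes sepX diamX ipm_bounded ipm_metrizes.
have leW := hipm_le_wasserstein sepX diamX F_measurable F_bounded ipm_bounded
  ipm_metrizes.
have weak := hipm_cvg_weak sepX diamX F_measurable F_bounded ipm_metrizes
  F_dense.
split; first split.
- move=> Q1 Q2; rewrite hipm_ge0 (le_lt_trans (leW Q1 Q2))//.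
  by have /andP[] := Wfin Q1 Q2.
- move=> Q1 Q2; split => [d0|Q12]; last first.
    apply: le_anti; rewrite hipm_ge0 andbT (le_trans (leW Q1 Q2))//.
    by rewrite (W0 Q1 Q2).2.
  have Q12 : (fun=> Q1) n @[n --> \oo] --> Q2.
    by apply: weak; rewrite d0; exact: cvg_cst.
  apply/W0.
  have /Wcvg := Q12; rewrite /= => /(cvg_lim _) <- //; rewrite lim_cst//.
- exact: hipm_sym.
- exact: (hipm_triangle sepX diamX F_measurable F_bounded ipm_metrizes).
move=> Q_ Q; split; first exact: weak.
move=> /Wcvg WQ.
apply: (squeeze_cvge _ _ WQ); last exact: cvg_cst.
by apply: nearW => n; rewrite hipm_ge0 leW.
Qed.

End hipm_metrizes.

Theorem theorem3p1 (R : realType) (X : completeMetricType R)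
    (sepX : separable X) (diamX : bounded_diameter X)
    (F : set (X -> R))
    (F_measurable : forall f, F f -> measurable_fun [set: borel X] f)
    (F_bounded : forall f, F f -> bounded_fun f)
    (ipm_bounded : exists M : R, forall P1 P2 : prob R X,
       (ipm F P1 P2 <= M%:E)%E)
    (ipm_metrizes : metrizes_weak (ipm F)) :
  metrizes_weak (wasserstein_ipm F) /\
  (affine_dense F -> metrizes_weak (hipm F)).
Proof.
split; first exact: wasserstein_ipm_metrizes.
exact: hipm_metrizes.
Qed.
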